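(* Let $\Omega\subset\mathbb R^n$ be open, $V$ a Banach space, and let $X(\Omega)$ be a Banach function space that has the Radon-Nikodým property and whose norm $\|\cdot\|_{X(\Omega)}$ has the translation inequality property. Suppose $u\in X(\Omega;V)$ and there is a non-negative function $h\in X(\Omega)$ such that $$\|u(x)-u(y)\|_V\le|x-y|\,(h(x)+h(y))\quad\text{a.e. on }\Omega,$$ i.e. for all $x,y\in\Omega\setminus N$ for some set $N$ of Lebesgue measure zero. Then $u\in R^1X(\Omega;V)$ and $\|g\|_{X(\Omega)}\le2n\|h\|_{X(\Omega)}$ for some Reshetnyak upper gradient $g$ of $u$.
   Context: Banach spaces are real; $|A|$ is Lebesgue measure. $M(\Omega)$ is the set of real-valued measurable functions on $\Omega$ (identified when equal a.e.). A Banach space $X(\Omega)\subset M(\Omega)$ with norm $\|\cdot\|_X$ (put $\|f\|_X=\infty$ if $f\notin X(\Omega)$) is a Banach function space if: (P1) $|f|\le g$, $f\in M(\Omega)$, $g\in X(\Omega)$ imply $f\in X(\Omega)$ and $\|f\|_X\le\|g\|_X$; (P2) $0\le f_n\nearrow f$ a.e. implies $\|f_n\|_X\nearrow\|f\|_X$; (P3) $\chi_A\in X(\Omega)$ for every measurable $A\subset\Omega$ with $|A|<\infty$; (P4) for every measurable $A\subset\Omega$ with $|A|<\infty$ there is $C_A>0$ with $\int_A|f|\,dx\le C_A\|f\chi_A\|_X$ for all $f\in X(\Omega)$. For $h\in\mathbb R^n$, $\tau_hu(x)=u(x+h)$ if $x+h\in\Omega$ and $\tau_hu(x)=0$ otherwise;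 the norm has the translation inequality property if $\|\tau_hu\|_X\le\|u\|_X$ for all $u\in X(\Omega)$, $h\in\mathbb R^n$. $X(\Omega;V)$ is the space of strongly measurable $u:\Omega\to V$ with $\|u(\cdot)\|_V\in X(\Omega)$. $W^1X(\Omega)$ is the space of real-valued $u\in X(\Omega)$ whose weak (distributional) partial derivatives $\partial_ju$ exist as $L^1_{loc}$ functions and belong to $X(\Omega)$; $|\nabla u|=\big(\sum_{j=1}^n|\partial_ju|^2\big)^{1/2}$. $R^1X(\Omega;V)$ (Reshetnyak--Sobolev space) is the class of $u\in X(\Omega;V)$ such that: (A) $\langle v^*,u\rangle\in W^1X(\Omega)$ for every $v^*\in V^*$ with $\|v^*\|\le1$; (B) there is a non-negative $g\in X(\Omega)$ such that for every $v^*\in V^*$ with $\|v^*\|\le 1$, $|\nabla\langle v^*,u\rangle|\le g$ a.e. on $\Omega$. Such a $g$ is called a Reshetnyak upper gradient of $u$. A Banach space $E$ has the Radon-Nikodým property if for every $\sigma$-finite complete measure space $(S,\Sigma,\mu)$ and every $E$-valued measure $\nu$ on $\Sigma$ of bounded variation that is absolutely continuous with respect to $\mu$ there is $f\in L^1(S;E)$ with $\nu(A)=\int_Af\,d\mu$ for all $A\in\Sigma$. Equivalently, every locally Lipschitz function $\mathbb R\to E$ is differentiable a.e. *)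

(* Defs.v *)
From HB Require Import structures.
From mathcomp Require Import all_boot all_order all_algebra.
From mathcomp Require Import all_classical all_reals all_analysis.

Set Implicit Arguments.
Unset Strict Implicit.
Unset Printing Implicit Defensive.
Import Order.TTheory GRing.Theory Num.Theory.
Import numFieldNormedType.Exports.

Local Open Scope classical_set_scope.
Local Open Scope ring_scope.

(* Lebesgue measure on R^n, n >= 1: the outer measure obtained from countable
   covers by open boxes, restricted to its Caratheodory sigma-algebra (that is,
   the complete sigma-algebra of Lebesgue measurable sets). *)

Section lebesgue_outer.
Context {R : realType} {n : nat}.
Local Notation Rn := 'rV[R]_n.+1.

Definition obox (a b : Rn) : set Rn :=
  [set x | forall i, a ord0 i < x ord0 i < b ord0 i].

Definition obox_volume (a b : Rn) : R :=
  \prod_i Num.max 0 (b ord0 i - a ord0 i).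

Definition obox_cover (A : set Rn) : set (nat -> Rn * Rn) :=
  [set c | A `<=` \bigcup_k obox (c k).1 (c k).2].

Local Open Scope ereal_scope.

Definition lebesgue_outer (A : set Rn) : \bar R :=
  ereal_inf [set \sum_(k <oo) (obox_volume (c k).1 (c k).2)%:E
            | c in obox_cover A].

Lemma obox_volume_ge0 a b : (0 <= obox_volume a b)%R.
Proof. by apply: prodr_ge0 => i _; rewrite le_max lexx. Qed.

Lemma lebesgue_outer_ge0 A : 0 <= lebesgue_outer A.
Proof.
apply: le_ereal_inf_tmp => _ [c _ <-].
by apply: nneseries_ge0 => k _ _; rewrite lee_fin obox_volume_ge0.
Qed.

Lemma le_lebesgue_outer :
  {homo lebesgue_outer : A B / A `<=` B >-> A <= B}.
Proof.
move=> A B AB; apply/ereal_inf_le_tmp => _ [c Bc <-].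
by exists c => //; exact: subset_trans Bc.
Qed.

Lemma lebesgue_outer0 : lebesgue_outer set0 = 0.
Proof.
apply/eqP; rewrite eq_le lebesgue_outer_ge0 andbT.
apply: ereal_inf_lbound; exists (fun=> (0%R, 0%R)); first exact: sub0set.
rewrite eseries0// => k _ _ /=.
by rewrite /obox_volume big_ord_recl subrr maxxx mul0r.
Qed.

Lemma lebesgue_outer_sigma_subadditive : sigma_subadditive lebesgue_outer.
Proof.
move=> A; have [[i ioo]|] := pselect (exists i, lebesgue_outer (A i) = +oo).
  rewrite (eseries_pinfty _ _ ioo) ?leey// => k _.
  by rewrite -ltNye (lt_le_trans _ (lebesgue_outer_ge0 _)).
rewrite -forallNE => Aoo.
suff add2e (e : {posnum R}) : lebesgue_outer (\bigcup_k A k) <=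
    \sum_(i <oo) lebesgue_outer (A i) + e%:num%:E.
  by apply/lee_addgt0Pr => _/posnumP[].
rewrite (le_trans _ (epsilon_trick _ _ _))//; last first.
  by move=> k; exact: lebesgue_outer_ge0.
pose v (c : Rn * Rn) := (obox_volume c.1 c.2)%:E.
have v0 c : 0 <= v c by rewrite lee_fin obox_volume_ge0.
pose P k (c : nat -> Rn * Rn) := obox_cover (A k) c /\
  \sum_(i <oo) v (c i) <= lebesgue_outer (A k) + (e%:num / (2 ^ k.+1)%:R)%:E.
have [G PG] : {G : nat -> nat -> Rn * Rn & forall k, P k (G k)}.
  apply: (@choice _ _ P) => k; rewrite /P /lebesgue_outer.
  set S := (X in ereal_inf X); move infS : (ereal_inf S) => iS.
  case: iS infS => [r Sr|Soo|Soo].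
  - have en1 : (0 < e%:num / (2 ^ k.+1)%:R)%R by [].
    have /(lb_ereal_inf_adherent en1) : ereal_inf S \is a fin_num by rewrite Sr.
    move=> [x [c Ac cx] xS].
    by exists c; split => //; rewrite /v cx -Sr; exact/ltW.
  - by have := Aoo k; rewrite /lebesgue_outer Soo.
  - by have := lebesgue_outer_ge0 (A k); rewrite /lebesgue_outer Soo.
have vG_ge0 x : 0 <= (v \o uncurry G) x by exact: v0.
apply: (@le_trans _ _ (\esum_(i in setT) (v \o uncurry G) i)).
  apply: ereal_inf_lbound => /=.
  have /card_esym/ppcard_eqP[f] := card_nat2.
  exists (uncurry G \o f).
    move=> t [i _] /((PG i).1)[j _ Gt]; exists (f^-1%FUN (i, j)) => //=.
    by rewrite invK ?inE.
  rewrite -(esum_pred_image (v \o uncurry G) _ xpredT) ?[fun=> _]set_true//.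
  by rewrite image_eq.
rewrite (_ : esum _ _ = \sum_(i <oo) \sum_(j <oo ) v (G i j)); last first.
  pose J : nat -> set (nat * nat) := fun i => [set (i, j) | j in setT].
  rewrite (_ : setT = \bigcup_k J k); last first.
    by rewrite predeqE => -[a b]; split => // _; exists a => //; exists b.
  rewrite esum_bigcupT /=; last 2 first.
    - apply/trivIsetP => i j _ _ ij.
      rewrite predeqE => -[k m] /=; split => //= -[] [_] _ [<-{k} _].
      by move=> [m' _] [] /esym/eqP; rewrite (negbTE ij).
    - by move=> -[k m]; exact: v0.
  rewrite -(image_id [set: nat]) -fun_true esum_pred_image//; last first.
    by move=> k _; exact: esum_ge0.
  apply: eq_eseriesr => /= j _.
  rewrite -(esum_pred_image (v \o uncurry G) (pair j) predT)//=; last first.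
    by move=> ? ? _ _; exact: (@can_inj _ _ _ snd).
  by congr esum; rewrite predeqE => -[a b]; split; move=> [i _ <-]; exists i.
apply: lee_lim.
- apply: is_cvg_nneseries => k *.
  by apply: nneseries_ge0 => m *; exact: v0.
- by apply: is_cvg_nneseries => k *; apply: adde_ge0 => //; exact: lebesgue_outer_ge0.
- by near=> k; apply: lee_sum => i _; exact: (PG i).2.
Unshelve. all: by end_near. Qed.

HB.instance Definition _ := isOuterMeasure.Build R Rn lebesgue_outer
  lebesgue_outer0 lebesgue_outer_ge0 le_lebesgue_outer
  lebesgue_outer_sigma_subadditive.

End lebesgue_outer.

HB.instance Definition _ (R : realType) (n : nat) :=
  @isMeasurable.Build (caratheodory_display (@lebesgue_outer R n)) 'rV[R]_n.+1
    (@lebesgue_outer R n).-caratheodory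
    (caratheodory_measurable_set0 (@lebesgue_outer R n))
    (@caratheodory_measurable_setC _ _ (@lebesgue_outer R n))
    (@caratheodory_measurable_bigcup _ _ (@lebesgue_outer R n)).

Definition lebesgue_rV (R : realType) (n : nat) :
  set 'rV[R]_n.+1 -> \bar R := @lebesgue_outer R n.

HB.instance Definition _ (R : realType) (n : nat) := isMeasure.Build
  (caratheodory_display (@lebesgue_outer R n)) 'rV[R]_n.+1 R (@lebesgue_rV R n)
  (@caratheodory_measure0 R _ (@lebesgue_outer R n))
  (@caratheodory_measure_ge0 R _ (@lebesgue_outer R n))
  (@caratheodory_measure_sigma_additive R _ (@lebesgue_outer R n)).

(* The norm of the matrix library is the sup norm; this is the Euclidean one. *)
Definition euclidean_norm (R : realType) (n : nat) (x : 'rV[R]_n.+1) : R :=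
  Num.sqrt (\sum_i x ord0 i ^+ 2).

Section bochner.
Context d (S : measurableType d) (R : realType).
Variable mu : {measure set S -> \bar R}.
Variable E : normedModType R.

Definition simple_function (s : S -> E) : Prop :=
  finite_set (range s) /\
  forall e : E, measurable (s @^-1` [set e]) /\
    (e != 0 -> (mu (s @^-1` [set e]) < +oo)%E).

Definition simple_integral (A : set S) (s : S -> E) : E :=
  \sum_(e \in [set: E]) fine (mu (A `&` s @^-1` [set e])) *: e.

Definition strongly_measurable (D : set S) (f : S -> E) : Prop :=
  exists s : nat -> S -> E, (forall k, simple_function (s k)) /\
    {ae mu, forall x, D x -> s ^~ x @ \oo --> f x}.

Definition bochner_integrable (f : S -> E) : Prop :=
  strongly_measurable setT f /\
  mu.-integrable setT (fun x => `|f x|%:E).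

(* [I] is the Bochner integral of [f] over [A] *)
Definition is_bochner_integral (A : set S) (f : S -> E) (I : E) : Prop :=
  exists s : nat -> S -> E, [/\ forall k, simple_function (s k),
    (fun k => \int[mu]_(x in A) `|f x - s k x|%:E)%E @ \oo --> 0%E &
    (fun k => simple_integral A (s k)) @ \oo --> I].

Definition vector_measure (nu : set S -> E) : Prop :=
  forall F : nat -> set S, (forall k, measurable (F k)) ->
    trivIset setT F -> series (nu \o F) @ \oo --> nu (\bigcup_k F k).

Definition vector_variation (nu : set S -> E) : \bar R :=
  ereal_sup [set z | exists (m : nat) (F : nat -> set S),
    [/\ forall k, measurable (F k), trivIset setT F &
        z = (\sum_(k < m) `|nu (F k)|)%:E]].

End bochner.

Definition radon_nikodym_property (R : realType)
    (E : completeNormedModType R) : Prop :=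
  forall (d : measure_display) (S : measurableType d)
    (mu : {measure set S -> \bar R}) (nu : set S -> E),
  sigma_finite setT mu -> measure_is_complete mu ->
  vector_measure nu -> (vector_variation nu < +oo)%E ->
  (forall A, measurable A -> mu A = 0%E -> nu A = 0) ->
  exists f : S -> E, bochner_integrable mu f /\
    forall A, measurable A -> is_bochner_integral mu A f (nu A).

(* A Banach space of classes of measurable functions on [Omega] modulo a.e.
   equality is given by an abstract Banach space [E] together with a map [rep]
   choosing a representative of each class.  Functions on [Omega] are total
   functions whose values outside [Omega] are ignored. *)
Section function_space.
Context {R : realType} {n : nat}.
Local Notation Rn := 'rV[R]_n.+1.
Local Notation mu := (@lebesgue_rV R n).
Variables (Omega : set Rn) (E : completeNormedModType R) (rep : E -> Rn -> R).

Definition fspace_mem (f : Rn -> R) : Prop :=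
  exists F : E, ae_eq mu Omega (rep F) f.

(* equal to [+oo] when [f] is not in the space, as [ereal_inf set0 = +oo] *)
Definition fspace_norm (f : Rn -> R) : \bar R :=
  ereal_inf [set `|F|%:E | F in [set F : E | ae_eq mu Omega (rep F) f]].

End function_space.

Record banach_function_space (R : realType) (n : nat)
    (Omega : set 'rV[R]_n.+1) := BanachFunctionSpace {
  bfs_space : completeNormedModType R;
  bfs_rep : bfs_space -> 'rV[R]_n.+1 -> R;
  bfs_measurable : forall F, measurable_fun Omega (bfs_rep F);
  bfs_linear : forall (a : R) (F G : bfs_space),
    ae_eq (@lebesgue_rV R n) Omega (bfs_rep (a *: F + G))
      (fun x => a * bfs_rep F x + bfs_rep G x);
  bfs_inj : forall F G : bfs_space,
    ae_eq (@lebesgue_rV R n) Omega (bfs_rep F) (bfs_rep G) -> F = G;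
  bfs_ideal : forall f g : 'rV[R]_n.+1 -> R,
    measurable_fun Omega f -> fspace_mem Omega bfs_rep g ->
    {ae @lebesgue_rV R n, forall x, Omega x -> `|f x| <= g x} ->
    fspace_mem Omega bfs_rep f /\
    (fspace_norm Omega bfs_rep f <= fspace_norm Omega bfs_rep g)%E;
  bfs_fatou : forall (f_ : nat -> 'rV[R]_n.+1 -> R) (f : 'rV[R]_n.+1 -> R),
    (forall k, measurable_fun Omega (f_ k)) -> measurable_fun Omega f ->
    {ae @lebesgue_rV R n, forall x, Omega x ->
      [/\ forall k, 0 <= f_ k x, nondecreasing_seq (f_ ^~ x) &
          f_ ^~ x @ \oo --> f x]} ->
    nondecreasing_seq (fun k => fspace_norm Omega bfs_rep (f_ k)) /\
    (fun k => fspace_norm Omega bfs_rep (f_ k)) @ \oo -->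
      fspace_norm Omega bfs_rep f;
  bfs_indic : forall A, measurable A -> A `<=` Omega ->
    (lebesgue_rV A < +oo)%E -> fspace_mem Omega bfs_rep (\1_A);
  bfs_integral : forall A, measurable A -> A `<=` Omega ->
    (lebesgue_rV A < +oo)%E ->
    exists2 C : R, 0 < C & forall f, fspace_mem Omega bfs_rep f ->
      (\int[@lebesgue_rV R n]_(x in A) `|f x|%:E <=
       C%:E * fspace_norm Omega bfs_rep (fun x => f x * \1_A x)%R)%E
}.

Definition translate (R : realType) (n : nat) (Omega : set 'rV[R]_n.+1)
    (h : 'rV[R]_n.+1) (f : 'rV[R]_n.+1 -> R) : 'rV[R]_n.+1 -> R :=
  fun x => if x + h \in Omega then f (x + h) else 0.

Section bfs.
Context {R : realType} {n : nat} {Omega : set 'rV[R]_n.+1}.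
Local Notation Rn := 'rV[R]_n.+1.
Local Notation mu := (@lebesgue_rV R n).
Variable X : banach_function_space Omega.

Definition bfs_mem (f : Rn -> R) : Prop := fspace_mem Omega (@bfs_rep _ _ _ X) f.

Definition bfs_norm (f : Rn -> R) : \bar R :=
  fspace_norm Omega (@bfs_rep _ _ _ X) f.

Definition translation_inequality : Prop :=
  forall (f : Rn -> R) (h : Rn), bfs_mem f ->
    (bfs_norm (translate Omega h f) <= bfs_norm f)%E.

Definition bochner_space_mem (V : normedModType R) (u : Rn -> V) : Prop :=
  strongly_measurable mu Omega u /\ bfs_mem (fun x => `|u x|).

End bfs.

Section weak_derivative.
Context {R : realType} {n : nat}.
Local Notation Rn := 'rV[R]_n.+1.
Local Notation mu := (@lebesgue_rV R n).
Variable Omega : set Rn.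

Definition partial (j : 'I_n.+1) (f : Rn -> R) : Rn -> R :=
  'D_(delta_mx ord0 j) f.

(* class C^oo: all iterated partial derivatives exist and are continuous *)
Definition smooth (f : Rn -> R) : Prop :=
  forall s : seq 'I_n.+1, continuous (foldr partial f s) /\
    forall (j : 'I_n.+1) (x : Rn),
      derivable (foldr partial f s) x (delta_mx ord0 j).

Definition test_function (phi : Rn -> R) : Prop :=
  [/\ smooth phi, compact (closure [set x | phi x != 0]) &
      closure [set x | phi x != 0] `<=` Omega].

Definition locally_integrable_rV (f : Rn -> R) : Prop :=
  measurable_fun Omega f /\
  forall K, K `<=` Omega -> compact K ->
    (\int[mu]_(x in K) `|f x|%:E < +oo)%E.

(* [Rintegral] is total, but both integrals below are of integrable functions
   since [w] and [g] are locally integrable and [phi] is a test function. *)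
Definition is_weak_partial (j : 'I_n.+1) (w g : Rn -> R) : Prop :=
  [/\ locally_integrable_rV w, locally_integrable_rV g &
      forall phi, test_function phi ->
        \int[mu]_(x in Omega) (w x * partial j phi x) =
        - \int[mu]_(x in Omega) (g x * phi x)].

End weak_derivative.

Definition dual_norm (R : realType) (V : normedModType R)
    (f : {linear V -> R^o}) : \bar R :=
  ereal_sup [set `|f v|%:E | v in [set v : V | `|v| <= 1]].

Section reshetnyak.
Context {R : realType} {n : nat} {Omega : set 'rV[R]_n.+1}.
Local Notation Rn := 'rV[R]_n.+1.
Local Notation mu := (@lebesgue_rV R n).
Variable X : banach_function_space Omega.

Definition sobolev_mem (w : Rn -> R) : Prop :=
  bfs_mem X w /\
  forall j, exists2 g, is_weak_partial Omega j w g & bfs_mem X g.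

Variable V : normedModType R.

Definition reshetnyak_upper_gradient (u : Rn -> V) (g : Rn -> R) : Prop :=
  [/\ bfs_mem X g,
      {ae mu, forall x, Omega x -> 0 <= g x} &
      forall f : {linear V -> R^o}, continuous f -> (dual_norm f <= 1)%E ->
        exists G : 'I_n.+1 -> Rn -> R,
          (forall j, is_weak_partial Omega j (fun x => f (u x)) (G j)) /\
          {ae mu, forall x, Omega x ->
            Num.sqrt (\sum_j G j x ^+ 2) <= g x}].

Definition reshetnyak_sobolev_mem (u : Rn -> V) : Prop :=
  [/\ bochner_space_mem X u,
      forall f : {linear V -> R^o}, continuous f -> (dual_norm f <= 1)%E ->
        sobolev_mem (fun x => f (u x)) &
      exists g, reshetnyak_upper_gradient u g].

End reshetnyak.

(* Main.v *)
From HB Require Import structures.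
Require Import Defs.
From mathcomp Require Import all_boot all_order all_algebra.
From mathcomp Require Import all_classical all_reals all_analysis measurable_realfun.
From mathcomp Require Import lra.

Set Implicit Arguments.
Unset Strict Implicit.
Unset Printing Implicit Defensive.
Import Order.TTheory GRing.Theory Num.Theory.
Import numFieldNormedType.Exports.
Import HBNNSimple.

Local Open Scope classical_set_scope.
Local Open Scope ring_scope.

(* Let w = <v*, u>, let e be the j-th basis vector and phi a test function.  For
   small t > 0 a translation of the integration variable gives
     int w(x) (phi(x - te) - phi(x)) / t dx = int (w(x + te) - w(x)) / t phi(x) dx,
   and the pointwise inequality bounds the right-hand side by
     int (h(x + te) + h(x)) |phi(x)| dx = int h(x) (|phi(x - te)| + |phi(x)|) dx.
   Letting t tend to 0 yields |int w d_j phi| <= 2 int h |phi|.  Hence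
   phi |-> - int w d_j phi is a bounded functional for the norm of L^1(2h dx); by
   Hahn-Banach and the scalar Radon-Nikodym theorem it is phi |-> int G phi with |G| <= 2h, and G is
   the weak derivative.  So 2 n h is an upper gradient, n being the dimension. *)

(** * Hahn-Banach *)

(** What carries the derivative into X is that the estimate is weighted: a density bounded pointwise
    by 2h lies in X by the ideal property, and since the bound is the same for every v*, one
    function controls all the gradients. The functional is given only on compactly supported
    functions; it is extended to the whole weighted space because a measure has to be read off
    indicator functions. Two features of the weight shape this reading: it may vanish, so the
    weighted norm is only a seminorm, and it may have infinite mass, so indicators need not belong
    to the space. Indicators are therefore multiplied by a positive function r for which 2hr is
    integrable, and the density found is divided by r afterwards. The integrals make sense because
    [bfs_integral] makes members of X integrable on compact subsets of Omega. With each partial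
    derivative bounded by 2h, the Euclidean length of the gradient is at most sqrt(n) 2h, which is
    rounded up to 2nh. *)

Section hahn_banach.
Context {R : realType} {V : lmodType R}.
Variables (W : V -> Prop) (p : V -> R).
Hypothesis W_lin : forall a x y, W x -> W y -> W (a *: x + y).
Hypothesis pZ : forall a x, W x -> p (a *: x) = `|a| * p x.
Hypothesis pD : forall x y, W x -> W y -> p (x + y) <= p x + p y.

(* A partial linear functional is handled through its graph; being dominated by
   [p] already forces such a graph to be single-valued. *)
Definition dominated_graph (f : set (V * R)) :=
  (forall a x r y s, f (x, r) -> f (y, s) -> f (a *: x + y, a * r + s)) /\
  (forall x r, f (x, r) -> W x /\ r <= p x).

(** Writing a x as (a - 1) x + x gives multiples without assuming that (0, 0) is in the graph. *)
Lemma dominated_graph_scale f a x r :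
  dominated_graph f -> f (x, r) -> f (a *: x, a * r).
Proof.
move=> [fl _] fx; have := fl (a - 1) _ _ _ _ fx fx.
by rewrite -[X in _ + X]scale1r -scalerDl -[X in _ * r + X]mul1r -mulrDl subrK.
Qed.

(** Two values r < s at x would put (0, s - r) in the graph, hence s - r <= p 0 = 0. *)
Lemma dominated_graph_fun f x r s :
  dominated_graph f -> f (x, r) -> f (x, s) -> r = s.
Proof.
move=> fd; wlog rs : r s / r < s => [H|] fr fs.
  by case: (ltgtP r s) => // ?; [exact: H|apply/esym; exact: H].
have := fd.1 (-1) _ _ _ _ fr fs; rewrite scaleN1r addNr mulN1r addrC => f0.
have [W0] := fd.2 _ _ f0.
by rewrite -(scale0r 0) pZ// normr0 mul0r subr_le0 leNgt rs.
Qed.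

(** The value c at x0 has to satisfy r - p (x - x0) <= c <= p (x + x0) - r for all (x, r) in f. The
    triangle inequality puts every left side below every right side, so the supremum of the left
    sides is such a value. *)
Lemma dominated_graph_extend f x0 : dominated_graph f -> f (0, 0) -> W x0 ->
  exists g, [/\ dominated_graph g, f `<=` g & exists r, g (x0, r)].
Proof.
move=> fd f0 Wx0; have [fl fp] := fd.
have WD x y : W x -> W y -> W (x + y).
  by move=> Wx Wy; rewrite -[x]scale1r; exact: W_lin.
have WZ a x : W x -> W (a *: x).
  by move=> Wx; rewrite -[X in W X]addr0; apply: W_lin => //; exact: (fp _ _ f0).1.
have WB x y : W x -> W y -> W (x - y).
  by move=> Wx Wy; apply: WD => //; rewrite -scaleN1r; exact: WZ.
pose S := [set t.2 - p (t.1 - x0) | t in f].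
have key x r y s : f (x, r) -> f (y, s) -> r - p (x - x0) <= p (y + x0) - s.
  move=> fx fy; have := (fp _ _ (fl 1 _ _ _ _ fx fy)).2.
  rewrite scale1r mul1r.
  have -> : x + y = (x - x0) + (y + x0) by rewrite [y + x0]addrC addrA subrK.
  have := pD (WB _ _ (fp _ _ fx).1 Wx0) (WD _ _ (fp _ _ fy).1 Wx0).
  by move: (p _) (p _) (p _) => A B C; lra.
pose c := sup S.
have hS : has_sup S.
  split; first by exists (0 - p (0 - x0)), (0, 0).
  by exists (p (0 + x0) - 0) => _ [[x r] fx <-]; exact: key.
have c1 x r : f (x, r) -> r - p (x - x0) <= c.
  by move=> fx; apply: ub_le_sup; [exact: hS.2|exists (x, r)].
have c2 x r : f (x, r) -> c <= p (x + x0) - r.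
  by move=> fx; apply: ge_sup; [exact: hS.1|move=> _ [[y s] fy <-]; exact: key].
exists [set t | exists x r a, [/\ f (x, r), t.1 = x + a *: x0 & t.2 = r + a * c]].
split.
- split.
    move=> a _ _ _ _ [x [r [b [fx /= -> ->]]]] [y [s [b' [fy /= -> ->]]]].
    exists (a *: x + y), (a * r + s), (a * b + b'); split; first exact: fl.
      by rewrite scalerDr scalerA addrACA -scalerDl.
    by rewrite mulrDr mulrA addrACA -mulrDl.
  move=> _ _ [x [r [a [fx /= -> ->]]]]; have [Wx rp] := fp _ _ fx.
  split; first exact: WD Wx (WZ _ _ Wx0).
  (* Scaling by 1 / |a| reduces the bound at x + a x0 to a = -1, settled by [c1], or to a = 1,
     settled by [c2]. *)
  have [a0|a0|->] := ltgtP a 0; last by rewrite scale0r mul0r !addr0.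
    have /c1 := dominated_graph_scale (- a)^-1 fd fx.
    have a'0 : 0 < (- a)^-1 by rewrite invr_gt0 oppr_gt0.
    have -> : (- a)^-1 *: x - x0 = (- a)^-1 *: (x + a *: x0).
      by rewrite scalerDr scalerA invrN mulNr mulVf ?lt_eqF// scaleN1r.
    rewrite pZ ?(gtr0_norm a'0); last exact: WD Wx (WZ _ _ Wx0).
    rewrite -mulrBr mulrC ler_pdivrMr ?oppr_gt0//; lra.
  have /c2 := dominated_graph_scale a^-1 fd fx.
  have a'0 : 0 < a^-1 by rewrite invr_gt0.
  have -> : a^-1 *: x + x0 = a^-1 *: (x + a *: x0).
    by rewrite scalerDr scalerA mulVf ?gt_eqF// scale1r.
  rewrite pZ ?(gtr0_norm a'0); last exact: WD Wx (WZ _ _ Wx0).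
  rewrite -mulrBr mulrC ler_pdivlMr//; lra.
- move=> [x r] fx; exists x, r, 0; split => //=.
    by rewrite scale0r addr0.
  by rewrite mul0r addr0.
- by exists c, 0, 0, 1; split => //=; rewrite ?scale1r ?mul1r add0r.
Qed.

(** The ambient V will be the module of all functions, and W the functions of finite weighted norm,
    where alone p is a seminorm. As p is symmetric, the one-sided bound on L yields a two-sided one
    on M. *)
Theorem hahn_banach (F : V -> Prop) (L : V -> R) :
  F 0 -> (forall a x y, F x -> F y -> F (a *: x + y)) ->
  (forall x, F x -> W x) ->
  (forall a x y, F x -> F y -> L (a *: x + y) = a * L x + L y) ->
  (forall x, F x -> L x <= p x) ->
  exists M : V -> R, [/\ forall x, F x -> M x = L x,
    forall a x y, W x -> W y -> M (a *: x + y) = a * M x + M y &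
    forall x, W x -> `|M x| <= p x].
Proof.
move=> F0 Flin FW Llin Lp.
pose gL := [set t : V * R | F t.1 /\ t.2 = L t.1].
have L0 : L 0 = 0.
  have := Llin (-1) _ _ F0 F0.
  by rewrite scaleN1r addNr mulN1r addNr.
have gLd : dominated_graph gL.
  split=> [a x r y s [/= Fx ->] [/= Fy ->]|x r [/= Fx ->]].
    by split => /=; [exact: Flin|rewrite Llin].
  by split; [exact: FW|exact: Lp].
(* Graphs are joined with [gL] inside the predicate so that the empty chain is no exception: its
   union is empty, and [gL] alone is dominated. *)
have [f [fP fmax]] : exists A, (fun f => dominated_graph (f `|` gL)) A /\
    forall B, A `<` B -> ~ dominated_graph (B `|` gL).
  apply: Zorn_bigcup => C CP Ctot.
  have tot2 s t : (\bigcup_(X in C) X `|` gL) s -> (\bigcup_(X in C) X `|` gL) t ->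
      exists Y, [/\ dominated_graph (Y `|` gL), (Y `|` gL) s, (Y `|` gL) t &
        Y `|` gL `<=` \bigcup_(X in C) X `|` gL].
    have sub X : C X -> X `|` gL `<=` \bigcup_(X in C) X `|` gL.
      by move=> CX; apply: setSU => z Xz; exists X.
    move=> [[X CX Xs]|gs] [[Y CY Yt]|gt].
    - have [XY|YX] := Ctot _ _ CX CY.
        by exists Y; split; [exact: CP|left; exact: XY|left|exact: sub].
      by exists X; split; [exact: CP|left|left; exact: YX|exact: sub].
    - by exists X; split; [exact: CP|left|right|exact: sub].
    - by exists Y; split; [exact: CP|right|left|exact: sub].
    - exists set0; split; [by rewrite set0U|by right|by right|].
      by rewrite set0U; right.
  split=> [a x r y s /tot2 h /h[Y [Yd Yx Yy Ysub]]|x r xr].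
    by apply: Ysub; exact: Yd.1.
  by have [Y [Yd Yx _ _]] := tot2 _ _ xr xr; exact: Yd.2.
set g := f `|` gL in fP.
have tot x : W x -> exists r, g (x, r).
  move=> Wx; have [k [kd gk [r kr]]] := dominated_graph_extend fP
    (or_intror (conj F0 (esym L0))) Wx.
  exists r; apply: contrapT => gr.
  have kE : k `|` gL = k by rewrite setUidl//; apply: subset_trans gk; right.
  apply: (fmax k); last by rewrite kE.
  split; last by move=> kf; apply: gr; left; exact: kf.
  by apply: subset_trans gk; left.
have /choice[M MP] : forall x, exists r, W x -> g (x, r).
  by move=> x; have [/tot[r]|nW] := pselect (W x); [exists r|exists 0].
have ML a x y : W x -> W y -> M (a *: x + y) = a * M x + M y.
  move=> Wx Wy; apply: (dominated_graph_fun fP (MP _ (W_lin a Wx Wy))).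
  by apply: fP.1; exact: MP.
exists M; split => //.
  move=> x Fx; apply: (dominated_graph_fun fP (MP _ (FW _ Fx))).
  by right.
move=> x Wx; have /fP.2[_ H1] := MP _ Wx.
have /fP.2[_] := dominated_graph_scale (-1) fP (MP _ Wx).
by rewrite pZ// normrN1 mul1r mulN1r => H2; rewrite ler_norml H1 andbT lerNl.
Qed.

End hahn_banach.

(** * Functionals bounded by a weighted L1 norm *)

Lemma measurable_funV_pos d (T : measurableType d) (R : realType) (f : T -> R) :
  measurable_fun setT f -> (forall x, 0 < f x) ->
  measurable_fun setT (fun x => (f x)^-1).
Proof.
move=> mf f0; rewrite (_ : (fun x => _) = (@powR R ^~ (-1)) \o f).
  by apply: measurableT_comp mf; exact: measurable_powR.
by apply/funext => x /=; rewrite powR_inv1// ltW.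
Qed.

(** * Integrals of real-valued functions *)

Section real_integrals.
Context d {T : measurableType d} {R : realType}.
Variable mu : {measure set T -> \bar R}.
Implicit Types f g : T -> R.

Lemma integrable_le f g : measurable_fun setT f ->
  mu.-integrable setT (EFin \o g) -> (forall x, `|f x| <= g x) ->
  mu.-integrable setT (EFin \o f).
Proof.
move=> mf ig fg; apply: (le_integrable measurableT _ _ ig).
  exact/measurable_EFinP.
by move=> x _ /=; rewrite lee_fin (le_trans (fg x))// ler_norm.
Qed.

Lemma integrableD_EFin f g :
  mu.-integrable setT (EFin \o f) -> mu.-integrable setT (EFin \o g) ->
  mu.-integrable setT (EFin \o (fun x => f x + g x)).
Proof. by move=> fi gi; exact: (integrableD measurableT fi gi). Qed.

Lemma integrableZ_EFin a f : mu.-integrable setT (EFin \o f) ->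
  mu.-integrable setT (EFin \o (fun x => a * f x)).
Proof. by move=> fi; exact: (integrableZl measurableT a fi). Qed.

Lemma Rintegral_sum I (s : seq I) (f : I -> T -> R) :
  (forall i, mu.-integrable setT (EFin \o f i)) ->
  mu.-integrable setT (EFin \o (fun x => \sum_(i <- s) f i x)) /\
  \int[mu]_x (\sum_(i <- s) f i x) = \sum_(i <- s) \int[mu]_x f i x.
Proof.
move=> fi; elim: s => [|i s [IH1 IH2]].
  under [X in _.-integrable _ (_ \o X)]funext do rewrite big_nil.
  under eq_Rintegral do rewrite big_nil.
  by rewrite big_nil Rintegral_cst// mul0r; split => //; exact: integrable0.
under [X in _.-integrable _ (_ \o X)]funext do rewrite big_cons.
under eq_Rintegral do rewrite big_cons.
rewrite big_cons -IH2 RintegralD//; split => //.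
exact: integrableD_EFin.
Qed.

Lemma dominated_cvg_Rintegral (f_ : nat -> T -> R) f g :
  (forall k, measurable_fun setT (f_ k)) -> measurable_fun setT f ->
  (forall x, f_ ^~ x @ \oo --> f x) ->
  mu.-integrable setT (EFin \o g) -> (forall k x, `|f_ k x| <= g x) ->
  (fun k => \int[mu]_x f_ k x) @ \oo --> \int[mu]_x f x.
Proof.
move=> mf_ mf cf ig f_g.
have [fi _ fc] := @dominated_convergence _ _ _ mu setT measurableT
  (fun k => EFin \o f_ k) (EFin \o f) (EFin \o g)
  (fun k => (measurable_EFinP _ _).2 (mf_ k)) ((measurable_EFinP _ _).2 mf)
  ltac:(by apply: aeW => x _; apply/fine_cvgP; split; [exact: nearW|exact: cf])
  ig ltac:(by apply: aeW => x k _; rewrite lee_fin).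
apply/fine_cvg; rewrite /Rintegral fineK//.
exact: (integrable_fin_num measurableT fi).
Qed.

(** On the set A where g < f, the positive function f - g has integral at most 0, so it vanishes
    a.e. on A and A is null. *)
Lemma ae_le_of_integral_le f g :
  mu.-integrable setT (EFin \o f) -> mu.-integrable setT (EFin \o g) ->
  (forall A, measurable A -> \int[mu]_(x in A) f x <= \int[mu]_(x in A) g x) ->
  {ae mu, forall x, f x <= g x}.
Proof.
move=> fi gi fg; pose A := [set x | g x < f x].
have [mf mg] : measurable_fun setT f /\ measurable_fun setT g.
  by split; apply/measurable_EFinP; exact: (measurable_int mu).
have mA : measurable A.
  rewrite (_ : A = (fun x => f x - g x) @^-1` `]0, +oo[).
    by rewrite -[X in measurable X]setTI; exact: (measurable_funB mf mg).
  by apply/seteqP; split => x /=; rewrite in_itv/= andbT subr_gt0.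
have fgi : mu.-integrable setT (EFin \o (f \- g)) by exact: (integrableB measurableT fi gi).
have fgA : mu.-integrable A (EFin \o (f \- g)) by exact: integrableS fgi.
have I0 : (\int[mu]_(x in A) `|(f \- g) x|%:E = 0)%E.
  under eq_integral => x xA.
    rewrite ger0_norm; last by move: xA; rewrite inE /A/= subr_ge0 => /ltW.
    over.
  apply/eqP; rewrite eq_le; apply/andP; split; last first.
    by apply: integral_ge0 => x; rewrite /A/= lee_fin subr_ge0 => /ltW.
  rewrite -[leLHS]fineK; last exact: (integrable_fin_num mA fgA).
  rewrite lee_fin -/(Rintegral _ _ _) RintegralB//; try exact: integrableS measurableT _ _ _.
  by rewrite subr_le0 fg.
have := (ae_eq_integral_abs mu mA (measurable_int _ fgA)).1 I0.
apply: filterS => x /= H; rewrite leNgt; apply/negP => xA.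
by have [/eqP] := H xA; rewrite subr_eq0 gt_eqF.
Qed.

End real_integrals.

(** The function is the sum of c_i times the indicator of F_i, for a cover F by sets of finite
    measure and c_i = 2^-(i+1) / (1 + mu F_i). Since c_i <= 2^-(i+1), the sum is at most 1
    everywhere; since c_i mu F_i <= 2^-(i+1), so is its integral. *)
Lemma sigma_finite_pos_integrable d (T : measurableType d) (R : realType)
    (mu : {sigma_finite_measure set T -> \bar R}) :
  exists r : T -> R, [/\ measurable_fun setT r, forall x, 0 < r x &
    mu.-integrable setT (EFin \o r)].
Proof.
have [F TF mF] := sigma_finiteT mu.
pose m i := 1 + fine (mu (F i)).
have m_gt0 i : 0 < m i by rewrite ltr_pwDl// fine_ge0.
pose c i : R := 1 / (2 ^ i.+1)%:R / m i.
have c_gt0 i : 0 < c i by rewrite !divr_gt0// ltr0n expn_gt0.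
have c_le i : c i <= 1 / (2 ^ i.+1)%:R.
  rewrite ler_pdivrMr// ler_peMr ?divr_ge0//.
  by rewrite lerDl fine_ge0.
pose t i x := (c i * \1_(F i) x)%:E.
have t_ge0 i x : (0 <= t i x)%E by rewrite lee_fin mulr_ge0// ltW.
have mt i : measurable_fun setT (t i).
  apply/measurable_EFinP/measurable_funM => //.
  by apply: measurable_indic; exact: (mF i).1.
pose s x := (\sum_(i <oo) t i x)%E.
have s_le x : (s x <= 1%:E)%E.
  apply: le_trans (epsilon_trick0 xpredT ler01).
  apply: lee_nneseries => // i _; rewrite lee_fin.
  apply: le_trans (c_le i); apply: ler_piMr; first exact: ltW.
  by rewrite indicE lern1 leq_b1.
have s_fin x : s x \is a fin_num.
  by rewrite ge0_fin_numE ?nneseries_ge0// (le_lt_trans (s_le x)) ?ltry.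
have ms : measurable_fun setT s by exact: ge0_emeasurable_sum.
exists (fine \o s); split.
- exact: measurableT_comp.
- move=> x; have [i _ Fx] : (\bigcup_i F i) x by rewrite -TF.
  rewrite -lte_fin fineK//; apply: (@lt_le_trans _ _ (t i x)).
    by rewrite lte_fin indicE mem_set// mulr1.
  rewrite /s (@nneseriesD1 _ _ i)// leeDl//.
  exact: nneseries_ge0.
- have sE : EFin \o (fine \o s) = s by apply/funext => x /=; rewrite fineK.
  rewrite sE; apply/integrableP; split => //.
  under eq_integral do rewrite gee0_abs ?nneseries_ge0//.
  rewrite integral_nneseries//; apply: (@le_lt_trans _ _ 1%:E); last exact: ltry.
  apply: le_trans (epsilon_trick0 xpredT ler01).
  apply: lee_nneseries => [i _ _|i _]; first exact: integral_ge0.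
  have [mFi Fi_fin] := mF i.
  rewrite /t; under eq_integral do rewrite EFinM.
  rewrite ge0_integralZl//; [|by apply/measurable_EFinP; exact: measurable_indic
    |by rewrite lee_fin ltW].
  rewrite integral_indic// setIT.
  have -> : ((c i)%:E * mu (F i) = (c i)%:E * (fine (mu (F i)))%:E)%E.
    by rewrite fineK ?ge0_fin_numE.
  have : c i * fine (mu (F i)) <= 1 / (2 ^ i.+1)%:R.
    rewrite /c -(mulrA (1 / _)) ler_piMr ?divr_ge0//.
    by rewrite mulrC ler_pdivrMr// mul1r lerDr.
  by rewrite -lee_fin EFinM.
Qed.

(** * Duality for the weighted L^1 space *)

Section weighted_L1_dual.
Context d {T : measurableType d} {R : realType}.
Variable mu : {sigma_finite_measure set T -> \bar R}.
Variable p : T -> R.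
Hypothesis mp : measurable_fun setT p.
Hypothesis p_ge0 : forall x, 0 <= p x.

(** Functions rather than classes: p may vanish, so [weighted_norm] is a seminorm, which is what
    [hahn_banach] asks for. *)
Definition weighted_L1 (f : T -> R^o) : Prop :=
  measurable_fun setT (f : T -> R) /\
  mu.-integrable setT (EFin \o (fun x => p x * `|f x|)).

Definition weighted_norm (f : T -> R^o) : R := \int[mu]_x (p x * `|f x|).

Lemma measurable_weight (f : T -> R) : measurable_fun setT f ->
  measurable_fun setT (fun x => p x * `|f x|).
Proof. by move=> mf; apply: measurable_funM => //; exact: measurableT_comp. Qed.

Lemma weighted_L1_le (f g : T -> R^o) : measurable_fun setT (f : T -> R) ->
  weighted_L1 g -> (forall x, `|f x| <= g x) -> weighted_L1 f.
Proof.
move=> mf [mg ig] fg; split => //; apply: (integrable_le _ ig).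
  exact: measurable_weight.
move=> x; rewrite normrM normr_id ger0_norm//; apply: ler_wpM2l => //.
by rewrite (le_trans (fg x))// ler_norm.
Qed.

Lemma weighted_L1_lin (a : R) (f g : T -> R^o) :
  weighted_L1 f -> weighted_L1 g -> weighted_L1 (a *: f + g).
Proof.
move=> [mf fi] [mg gi].
have mfg : measurable_fun setT ((a *: f + g) : T -> R).
  by apply: measurable_funD => //; apply: measurable_funM.
split => //.
apply: (@integrable_le _ _ _ _ _ (fun x => `|a| * (p x * `|f x|) + p x * `|g x|)).
- exact: measurable_weight.
- by apply: integrableD_EFin => //; exact: integrableZ_EFin.
- move=> x; rewrite normrM normr_id ger0_norm// mulrCA -mulrDr.
  by apply: ler_wpM2l => //; rewrite (le_trans (ler_normD _ _))// normrM.
Qed.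

Lemma weighted_normZ (a : R) (f : T -> R^o) : weighted_L1 f ->
  weighted_norm (a *: f) = `|a| * weighted_norm f.
Proof.
move=> [mf fi]; rewrite /weighted_norm -RintegralZl//.
by apply: eq_Rintegral => x _; rewrite normrM mulrCA.
Qed.

Lemma weighted_normD (f g : T -> R^o) : weighted_L1 f -> weighted_L1 g ->
  weighted_norm (f + g) <= weighted_norm f + weighted_norm g.
Proof.
move=> fW gW; rewrite /weighted_norm -RintegralD//; [|exact: fW.2|exact: gW.2].
apply: le_Rintegral => //.
- by have [_] := weighted_L1_lin 1 fW gW; rewrite scale1r.
- exact: (integrableD measurableT fW.2 gW.2).
- by move=> x _; rewrite -mulrDr ler_wpM2l// ler_normD.
Qed.

Section representation.
Variable M : (T -> R^o) -> R.
Hypothesis M_lin : forall a f g, weighted_L1 f -> weighted_L1 g ->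
  M (a *: f + g) = a * M f + M g.
Hypothesis M_le : forall f, weighted_L1 f -> `|M f| <= weighted_norm f.
Variable r : T -> R.
Hypothesis mr : measurable_fun setT r.
Hypothesis r_gt0 : forall x, 0 < r x.
Hypothesis rp : mu.-integrable setT (EFin \o (p \* r)).

Lemma weighted_L1_0 : weighted_L1 0.
Proof.
split; first exact: measurable_cst.
apply: (@integrable_le _ _ _ _ _ (p \* r)) => //.
  by apply: measurable_weight; exact: measurable_cst.
by move=> x; rewrite normr0 mulr0 normr0 mulr_ge0// ltW.
Qed.

Lemma functional0 : M 0 = 0.
Proof.
have := M_lin (-1) weighted_L1_0 weighted_L1_0.
by rewrite scaleN1r addNr mulN1r addNr.
Qed.

Lemma functional_sum I (s : seq I) (c : I -> R) (f : I -> T -> R^o) :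
  (forall i, weighted_L1 (f i)) ->
  weighted_L1 (\sum_(i <- s) c i *: f i) /\
  M (\sum_(i <- s) c i *: f i) = \sum_(i <- s) c i * M (f i).
Proof.
move=> fW; elim: s => [|i s [IH1 IH2]].
  by rewrite !big_nil; split; [exact: weighted_L1_0|exact: functional0].
rewrite !big_cons; split; first exact: weighted_L1_lin.
by rewrite M_lin// IH2.
Qed.

(** |M f_k - M f| is at most the weighted norm of f_k - f, which tends to 0 by dominated convergence
    with dominating function 2 p |g|. This gives the countable additivity of the charge below and
    carries the integral formula from simple functions to their limits. *)
Lemma functional_dominated_cvg (f_ : nat -> T -> R^o) (f g : T -> R^o) :
  (forall k, weighted_L1 (f_ k)) -> weighted_L1 f -> weighted_L1 g ->
  (forall x, (fun k => f_ k x : R) @ \oo --> (f x : R)) ->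
  (forall k x, `|f_ k x| <= g x) ->
  (fun k => M (f_ k)) @ \oo --> M f.
Proof.
move=> f_W fW gW cf f_g.
have g_ge0 x : 0 <= g x by exact: le_trans (f_g 0%N x).
have f_g' x : `|f x| <= g x.
  have : (fun k => `|f_ k x| : R) @ \oo --> (`|f x| : R) by exact: cvg_norm (cf x).
  move=> /cvg_lim <- //; apply: limr_le; last exact: nearW.
  by apply/cvg_ex; exists `|f x|; exact: cvg_norm (cf x).
have dW k : weighted_L1 (f_ k - f).
  by rewrite addrC -scaleN1r; exact: weighted_L1_lin.
have H : (fun k => weighted_norm (f_ k - f)) @ \oo --> \int[mu]_x (0 : R).
  apply: (@dominated_cvg_Rintegral _ _ _ _ _ _ (fun x => 2 * (p x * `|g x|))).
  - by move=> k; apply: measurable_weight; exact: (dW k).1.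
  - exact: measurable_cst.
  - move=> x; rewrite -(mulr0 (p x)); apply: cvgMr.
    rewrite -[X in _ --> X](normr0 R); apply: cvg_norm.
    by rewrite -(subrr (f x : R)); apply: cvgB (cf x) _; exact: cvg_cst.
  - exact: integrableZ_EFin gW.2.
  - move=> k x; rewrite normrM normr_id ger0_norm// mulrCA ler_wpM2l//.
    rewrite (ger0_norm (g_ge0 x)) (le_trans (ler_normB _ _))// mulr_natl mulr2n.
    exact: lerD.
rewrite Rintegral_cst// mul0r in H.
have : (fun k => M (f_ k) - M f) @ \oo --> (0 : R).
  apply/norm_cvg0P; apply: (squeeze_cvgr _ (cvg_cst 0) H).
  apply: nearW => k; rewrite normr_ge0/=.
  rewrite -mulN1r addrC -M_lin// scaleN1r addrC.
  exact: M_le.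
by move=> /(cvgD (cvg_cst (M f))); rewrite addr0; under eq_cvg do rewrite addrC subrK.
Qed.

(** A bare indicator may have infinite weighted norm; the factor r, for which p r is integrable,
    admits every measurable A, the whole space included. *)
Definition weighted_indic (A : set T) : T -> R^o := fun x => r x * \1_A x.

Lemma weighted_L1_r : weighted_L1 r.
Proof.
split => //; apply: (integrable_le _ rp); first exact: measurable_weight.
by move=> x; rewrite normrM normr_id ger0_norm// (gtr0_norm (r_gt0 x)).
Qed.

Lemma weighted_L1_indic A : measurable A -> weighted_L1 (weighted_indic A).
Proof.
move=> mA; apply: (weighted_L1_le _ weighted_L1_r).
  by apply: measurable_funM => //; exact: measurable_indic.
move=> x; rewrite normrM (gtr0_norm (r_gt0 x)) ler_piMr ?(ltW (r_gt0 x))//.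
by rewrite indicE normr_nat lern1 leq_b1.
Qed.

(* The charge whose density with respect to [mu] is [r] times the function
   representing [M]. *)
Definition functional_charge (A : set T) : \bar R := (M (weighted_indic A))%:E.

Let functional_charge0 : functional_charge set0 = 0%E.
Proof.
rewrite /functional_charge (_ : weighted_indic set0 = 0) ?functional0//.
by apply/funext => x; rewrite /weighted_indic indic0 mulr0.
Qed.

Let functional_charge_fin A : measurable A -> functional_charge A \is a fin_num.
Proof. by []. Qed.

Let functional_charge_sigma_additive : semi_sigma_additive functional_charge.
Proof.
move=> F mF tF mU; rewrite /functional_charge.
apply/fine_cvgP; split; first by apply: nearW => k; rewrite sumEFin.
have E k : fine (\sum_(0 <= i < k) (M (weighted_indic (F i)))%:E) =
    M (\sum_(0 <= i < k) 1 *: weighted_indic (F i)).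
  rewrite sumEFin/= (@functional_sum _ _ (fun=> 1) _ _).2; last first.
    by move=> i; exact: weighted_L1_indic.
  by apply: eq_bigr => i _; rewrite mul1r.
rewrite (_ : _ \o _ = fun k => M (\sum_(0 <= i < k) 1 *: weighted_indic (F i)));
  last by apply/funext => k /=; rewrite E.
have sE k x : (\sum_(0 <= i < k) 1 *: weighted_indic (F i)) x =
    r x * \sum_(0 <= i < k) \1_(F i) x :> R.
  rewrite fct_sumE mulr_sumr; apply: eq_bigr => i _.
  exact: (mul1r (r x * \1_(F i) x)).
(* Pointwise convergence of these partial sums is the countable additivity of the Dirac measure at
   x. *)
have cs x : (fun k => \sum_(0 <= i < k) \1_(F i) x : R) @ \oo -->
    (\1_(\bigcup_n F n) x : R).
  have := (fine_cvgP _ _).1 (@measure_semi_sigma_additive _ _ R (dirac x) F mF tF mU).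
  move=> [_]; apply: cvg_trans; apply: near_eq_cvg; apply: nearW => k /=.
  by rewrite /dirac sumEFin.
apply: (@functional_dominated_cvg _ _ (weighted_indic (\bigcup_n F n))).
- by move=> k; apply: (functional_sum _ _ _).1 => i; exact: weighted_L1_indic.
- exact: weighted_L1_indic.
- exact: weighted_L1_indic.
- by move=> x; under eq_cvg do rewrite sE; apply: cvgMr; exact: cs.
- move=> k x; rewrite sE ger0_norm; last first.
    by rewrite mulr_ge0 ?(ltW (r_gt0 x))// sumr_ge0.
  apply: ler_wpM2l; first exact: ltW.
  move: (cs x) => /cvg_lim <- //.
  apply: nondecreasing_cvgn_le; last by apply/cvg_ex; exists (\1_(\bigcup_n F n) x); exact: cs.
  by apply/nondecreasing_seqP => n; rewrite big_nat_recr//= lerDl.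
Qed.

HB.instance Definition _ := isCharge.Build _ _ _ functional_charge
  functional_charge0 functional_charge_fin functional_charge_sigma_additive.

Lemma functional_indic_le A : measurable A ->
  `|M (weighted_indic A)| <= \int[mu]_(x in A) (p x * r x).
Proof.
move=> mA; rewrite (le_trans (M_le (weighted_L1_indic mA)))//.
rewrite Rintegral_mkcond le_eqVlt; apply/orP; left; apply/eqP.
apply: eq_Rintegral => x _.
rewrite normrM (gtr0_norm (r_gt0 x)) mulrA indicE patchE.
by case: (x \in A); rewrite ?normr1 ?normr0 ?mulr1 ?mulr0.
Qed.

Lemma functional_charge_dominates : functional_charge `<< mu.
Proof.
apply/null_content_dominatesP => A mA A0; rewrite /functional_charge.
apply/eqP; rewrite eqe -normr_le0 (le_trans (functional_indic_le mA))//.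
rewrite /Rintegral null_set_integral//.
by apply/measurable_EFinP; apply: measurable_funTS; exact: measurable_funM.
Qed.

(** |M (r 1_A)| is at most the integral of p r over A for every A, so the Radon-Nikodym density of
    the charge lies a.e. between -p r and p r. *)
Lemma functional_density : exists H : T -> R,
  [/\ measurable_fun setT H, forall x, `|H x| <= p x * r x &
    forall A, measurable A -> M (weighted_indic A) = \int[mu]_(x in A) H x].
Proof.
pose h := Radon_Nikodym functional_charge mu.
have hfin x : h x \is a fin_num.
  by apply: Radon_Nikodym_fin_num; exact: functional_charge_dominates.
have hE : EFin \o (fine \o h) = h by apply/funext => x /=; rewrite fineK.
have hi : mu.-integrable setT (EFin \o (fine \o h)).
  by rewrite hE; apply: Radon_Nikodym_integrable; exact: functional_charge_dominates.
have hA A : measurable A -> M (weighted_indic A) = \int[mu]_(x in A) (fine \o h) x.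
  move=> mA; have := Radon_Nikodym_integral functional_charge_dominates mA.
  rewrite /functional_charge /Rintegral => /(congr1 fine) /= ->.
  by congr fine; apply: eq_integral => x _; rewrite /= fineK.
have mh : measurable_fun setT (fine \o h).
  by apply/measurable_EFinP; exact: (measurable_int mu).
have h1 : {ae mu, forall x, (fine \o h) x <= (p \* r) x}.
  apply: ae_le_of_integral_le => // A mA.
  by rewrite -hA// (le_trans (ler_norm _))// functional_indic_le.
have h2 : {ae mu, forall x, -1 * (fine \o h) x <= (p \* r) x}.
  apply: ae_le_of_integral_le => //; first exact: integrableZ_EFin.
  move=> A mA; rewrite RintegralZl//; last exact: integrableS hi.
  by rewrite -hA// mulN1r (le_trans (ler_norm _))// normrN functional_indic_le.
(* Clamping changes the density on a null set only and makes the bound hold at every point. *)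
pose H x := Num.min (p x * r x) (Num.max (- (p x * r x)) (fine (h x))).
have mpr : measurable_fun setT (p \* r) by exact: measurable_funM.
have mH : measurable_fun setT H.
  apply: measurable_minr => //; apply: measurable_maxr => //.
  exact: measurableT_comp.
exists H; split => //.
  move=> x; have pr0 : 0 <= p x * r x by rewrite mulr_ge0// ltW.
  rewrite ler_norml; apply/andP; split; last by rewrite ge_min lexx.
  by rewrite le_min le_max lexx/= andbT (le_trans _ pr0)// oppr_le0.
move=> A mA; rewrite hA// /Rintegral; congr fine.
apply: ae_eq_integral => //.
- by apply/measurable_EFinP; exact: measurable_funTS.
- by apply/measurable_EFinP; exact: measurable_funTS.
near=> x => Ax /=; congr (_%:E).
rewrite /H max_r ?min_r//.
- by near: x; exact: h1.
- rewrite lerNl -mulN1r; near: x; exact: h2.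
Unshelve. all: by end_near. Qed.

(** G is the density of the charge divided by r. The formula passes from r 1_A to r times simple
    functions by linearity, to non-negative f by dominated convergence, and to every f through its
    positive and negative parts. *)
Theorem functional_integral : exists G : T -> R,
  [/\ measurable_fun setT G, forall x, `|G x| <= p x &
    forall f, weighted_L1 f -> M f = \int[mu]_x (f x * G x)].
Proof.
have [H [mH Hpr HM]] := functional_density.
have r_neq0 x : r x != 0 by rewrite gt_eqF.
have mrV : measurable_fun setT (fun x => (r x)^-1).
  exact: measurable_funV_pos.
pose G x := H x * (r x)^-1.
have mG : measurable_fun setT G by exact: measurable_funM.
have Gp x : `|G x| <= p x.
  by rewrite normrM normfV (gtr0_norm (r_gt0 x)) ler_pdivrMr.
have fGi f : weighted_L1 f -> mu.-integrable setT (EFin \o (fun x => f x * G x)).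
  move=> [mf fi]; apply: (integrable_le _ fi); first exact: measurable_funM.
  by move=> x; rewrite normrM mulrC ler_wpM2r.
have simple (s : {nnsfun T >-> R}) f : weighted_L1 f ->
    (forall x, r x * s x <= f x) ->
    weighted_L1 (fun x => r x * s x) /\
    M (fun x => r x * s x) = \int[mu]_x ((r x * s x) * G x).
  move=> fW sf; split.
    apply: weighted_L1_le fW _; first by apply: measurable_funM => //.
    by move=> x; rewrite ger0_norm// mulr_ge0// ltW.
  pose S : seq R := finmap.enum_fset (fset_set (range s)).
  pose F (i : 'I_(size S)) := weighted_indic (s @^-1` [set S`_i]).
  have FW i : weighted_L1 (F i) by exact: weighted_L1_indic.
  have sE : (fun x => r x * s x) = \sum_(i < size S)
      S`_i *: F i.
    apply/funext => x; rewrite fimfunEord mulr_sumr fct_sumE.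
    by apply: eq_bigr => i _; rewrite mulrCA.
  rewrite {1}sE (functional_sum _ _ FW).2.
  transitivity (\int[mu]_x \sum_(i < size S)
      S`_i * (F i x * G x)); last first.
    apply: eq_Rintegral => x _; rewrite -[RHS]/((fun x => r x * s x) x * G x) sE.
    by rewrite fct_sumE mulr_suml; apply: eq_bigr => i _; rewrite mulrA.
  rewrite (Rintegral_sum _ _).2; last first.
    by move=> i; apply: integrableZ_EFin; exact: fGi.
  apply: eq_bigr => i _; rewrite RintegralZl//; last exact: fGi.
  congr (_ * _); rewrite HM// Rintegral_mkcond; apply: eq_Rintegral => x _.
  rewrite patchE /F /weighted_indic indicE /G.
  case: ifPn => _; last by rewrite mulr0 mul0r.
  by rewrite mulr1 mulrCA divff// mulr1.
have pos f : weighted_L1 f -> (forall x, 0 <= f x) -> M f = \int[mu]_x (f x * G x).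
  (* The simple functions approximate f / r instead of f, because M is known on r times a simple
     function; r s_k converges to f and stays below f. *)
  move=> fW f0; pose q x := (f x * (r x)^-1)%:E.
  have mq : measurable_fun setT q.
    by apply/measurable_EFinP; apply: measurable_funM => //; exact: fW.1.
  have q0 x : setT x -> (0 <= q x)%E.
    by move=> _; rewrite lee_fin mulr_ge0 ?invr_ge0// ltW.
  pose s := nnsfun_approx measurableT mq.
  have sf k x : r x * s k x <= f x.
    rewrite mulrC -ler_pdivlMr// -lee_fin /s nnsfun_approxE.
    exact: (le_approx _ q0).
  have cs x : (fun k => r x * s k x : R) @ \oo --> (f x : R).
    have -> : f x = r x * (f x * (r x)^-1) by rewrite mulrCA divff// mulr1.
    apply: cvgMr.
    by have /fine_cvgP[_] := cvg_nnsfun_approx measurableT mq q0 (I : setT x).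
  have rs0 k x : 0 <= r x * s k x by rewrite mulr_ge0// ltW.
  have sW k := simple (s k) f fW (sf k).
  have c1 : (fun k => M (fun x => r x * s k x)) @ \oo --> M f.
    apply: (functional_dominated_cvg (g := f)) => //.
      by move=> k; exact: (sW k).1.
    by move=> k x; rewrite ger0_norm.
  have c2 : (fun k => M (fun x => r x * s k x)) @ \oo --> \int[mu]_x (f x * G x).
    under eq_cvg do rewrite (sW _).2.
    apply: (@dominated_cvg_Rintegral _ _ _ _ _ _ (fun x => p x * `|f x|)).
    - by move=> k; apply: measurable_funM => //; exact: (sW k).1.1.
    - by apply: measurable_funM => //; exact: fW.1.
    - by move=> x; apply: cvgMl; exact: cs.
    - exact: fW.2.
    - move=> k x; rewrite normrM mulrC; apply: ler_pM => //.
      by rewrite !ger0_norm.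
  by apply: (cvg_unique _ c1 c2).
exists G; split => // f fW.
pose fp : T -> R^o := fun x => 2^-1 * (`|f x| + f x).
pose fn : T -> R^o := fun x => 2^-1 * (`|f x| - f x).
have nW : weighted_L1 (fun x => `|f x|).
  split; first by apply: measurableT_comp => //; exact: fW.1.
  by under [X in _.-integrable _ (_ \o X)]funext do rewrite normr_id; exact: fW.2.
have fpW : weighted_L1 fp.
  apply: (weighted_L1_le _ nW).
    by apply: measurable_funM => //; apply: measurable_funD; [exact: nW.1|exact: fW.1].
  move=> x; rewrite ger0_norm; last first.
    by rewrite mulr_ge0//; have := ler_norm (- (f x : R)); rewrite normrN; lra.
  by have := ler_norm (f x); rewrite /fp; lra.
have fnW : weighted_L1 fn.
  apply: (weighted_L1_le _ nW).
    by apply: measurable_funM => //; apply: measurable_funB; [exact: nW.1|exact: fW.1].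
  move=> x; rewrite ger0_norm; last by rewrite mulr_ge0// subr_ge0 ler_norm.
  by have := ler_norm (- (f x : R)); rewrite normrN /fn; lra.
have fE : f = (-1) *: fn + fp.
  apply/funext => x; rewrite -[RHS]/(-1 * fn x + fp x : R) /fn /fp.
  by move: `|f x| (f x : R) => y z; lra.
have fp0 x : 0 <= fp x.
  by rewrite mulr_ge0//; have := ler_norm (- (f x : R)); rewrite normrN; lra.
have fn0 x : 0 <= fn x by rewrite mulr_ge0// subr_ge0 ler_norm.
rewrite {1}fE M_lin// (pos _ fpW fp0) (pos _ fnW fn0).
rewrite -RintegralZl//; last exact: fGi.
rewrite -RintegralD//; [|by apply: integrableZ_EFin; exact: fGi|exact: fGi].
by apply: eq_Rintegral => x _; rewrite /fn /fp; lra.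
Qed.

End representation.

Theorem weighted_L1_dual (F : (T -> R^o) -> Prop) (L : (T -> R^o) -> R) :
  F 0 -> (forall a f g, F f -> F g -> F (a *: f + g)) ->
  (forall f, F f -> weighted_L1 f) ->
  (forall a f g, F f -> F g -> L (a *: f + g) = a * L f + L g) ->
  (forall f, F f -> L f <= weighted_norm f) ->
  exists G : T -> R, [/\ measurable_fun setT G, forall x, `|G x| <= p x &
    forall f, F f -> L f = \int[mu]_x (f x * G x)].
Proof.
move=> F0 Flin FW Llin Lp.
have [M [ML Mlin Mp]] := hahn_banach weighted_L1_lin weighted_normZ weighted_normD
  F0 Flin FW Llin Lp.
have [r0 [mr0 r0_gt0 r0i]] := sigma_finite_pos_integrable mu.
have p1_gt0 x : 0 < 1 + p x by rewrite ltr_pwDl.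
(* Since p / (1 + p) <= 1, the product p r is bounded by the integrable r0, however large p is. *)
pose r x := r0 x * (1 + p x)^-1.
have mr : measurable_fun setT r.
  apply: measurable_funM => //; apply: measurable_funV_pos => //.
  exact: measurable_funD.
have r_gt0 x : 0 < r x by rewrite mulr_gt0// invr_gt0.
have rp : mu.-integrable setT (EFin \o (p \* r)).
  apply: (integrable_le _ r0i); first exact: measurable_funM.
  move=> x; have prx : 0 <= p x * r x by rewrite mulr_ge0// ltW.
  rewrite (ger0_norm prx) /r mulrCA.
  apply: ler_piMr; first exact: ltW.
  by rewrite ler_pdivrMr// mul1r lerDr.
have [G [mG Gp GM]] := functional_integral Mlin Mp mr r_gt0 rp.
exists G; split => // f Ff.
by rewrite -ML// GM//; exact: FW.
Qed.

End weighted_L1_dual.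
(** * Lebesgue measure on R^n *)

Section lebesgue_rV_theory.
Context {R : realType} {n : nat}.
Local Notation Rn := 'rV[R]_n.+1.
Local Notation outer := (@lebesgue_outer R n).
Local Notation mu := (@lebesgue_rV R n).
Implicit Types (a b x : Rn) (A : set Rn).

Lemma lebesgue_outer_obox a b : (outer (obox a b) <= (obox_volume a b)%:E)%E.
Proof.
(* The single box is padded to a sequence by boxes with both corners at 0, of volume 0. *)
apply: ereal_inf_lbound; exists (fun k => if k == 0%N then (a, b) else (0, 0)).
  by move=> x abx; exists 0%N.
rewrite (@nneseriesD1 _ _ 0%N)//; last by move=> k _; rewrite lee_fin obox_volume_ge0.
rewrite eseries0 ?adde0// => -[|k] _ //= _.
by rewrite /obox_volume big_ord_recl subrr maxxx mul0r.
Qed.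

Definition set_coord a (i : 'I_n.+1) (c : R) : Rn :=
  \row_j (if j == i then c else a ord0 j).

Definition cross_section a b (i : 'I_n.+1) : R :=
  \prod_(j | j != i) Num.max 0 (b ord0 j - a ord0 j).

Lemma cross_section_ge0 a b i : 0 <= cross_section a b i.
Proof. by apply: prodr_ge0 => j _; rewrite le_max lexx. Qed.

Lemma obox_volumeE a b i :
  obox_volume a b = Num.max 0 (b ord0 i - a ord0 i) * cross_section a b i.
Proof. by rewrite /obox_volume (bigD1 i). Qed.

Lemma obox_volume_set_coordl a b i c :
  obox_volume (set_coord a i c) b = Num.max 0 (b ord0 i - c) * cross_section a b i.
Proof.
rewrite (obox_volumeE _ _ i) mxE eqxx; congr (_ * _).
by apply: eq_bigr => j /negPf ji; rewrite mxE ji.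
Qed.

Lemma obox_volume_set_coordr a b i c :
  obox_volume a (set_coord b i c) = Num.max 0 (c - a ord0 i) * cross_section a b i.
Proof.
rewrite (obox_volumeE _ _ i) mxE eqxx; congr (_ * _).
by apply: eq_bigr => j /negPf ji; rewrite mxE ji.
Qed.

Definition half_space (i : 'I_n.+1) (c : R) : set Rn := [set x | x ord0 i < c].

(* The complementary half space is closed, so its part of the box is covered by
   an open box overlapping the other one in a slab of width [e]. *)
Lemma lebesgue_outer_obox_half_space a b i c :
  (outer (obox a b `&` half_space i c) + outer (obox a b `&` ~` half_space i c)
   <= (obox_volume a b)%:E)%E.
Proof.
apply/lee_addgt0Pr => e e0.
pose P := cross_section a b i; have P0 : 0 <= P := cross_section_ge0 a b i.
(* The overlap of width d costs the volume d P; the denominator 1 + P keeps it at most e, also when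
   P = 0. *)
pose d := e / (1 + P); have P1 : 0 < 1 + P by rewrite ltr_pwDl.
have d0 : 0 < d by rewrite divr_gt0.
have dP : d * P <= e.
  by rewrite /d mulrAC ler_pdivrMr// ler_pM2l// lerDr.
pose b' := set_coord b i (Num.min c (b ord0 i)).
pose a' := set_coord a i (Num.max (c - d) (a ord0 i)).
apply: (@le_trans _ _ ((obox_volume a b')%:E + (obox_volume a' b)%:E)%E).
  apply: leeD.
  - apply: le_trans (lebesgue_outer_obox a b'); apply: le_lebesgue_outer.
    move=> x [abx xc] j; have /andP[-> /=] := abx j.
    by rewrite mxE; case: eqP => [->|//]; rewrite lt_min => ->; rewrite andbT.
  - apply: le_trans (lebesgue_outer_obox a' b); apply: le_lebesgue_outer.
    move=> x [abx /negP]; rewrite -leNgt => xc j; have /andP[+ ->] := abx j.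
    rewrite andbT mxE; case: eqP => [->|//]; rewrite gt_max => ->; rewrite andbT.
    by rewrite (lt_le_trans _ xc)// ltrBlDr ltrDl.
rewrite -!EFinD lee_fin obox_volume_set_coordl obox_volume_set_coordr.
rewrite (obox_volumeE a b i) -/P -mulrDl.
apply: le_trans (lerD (lexx _) dP); rewrite -mulrDl ler_wpM2r//.
by rewrite /Num.max /Num.min; repeat case: ltP => ?; lra.
Qed.

(** Caratheodory's condition concerns arbitrary sets A; a countable cover of A by boxes reduces it
    to the splitting of each box. *)
Lemma measurable_half_space i c : measurable (half_space i c).
Proof.
apply: (@le_caratheodory_measurable R _ outer) => A.
apply: le_ereal_inf_tmp => _ [f fA <-].
pose B k := obox (f k).1 (f k).2.
have sub D : (outer (A `&` D) <= \sum_(k <oo) outer (B k `&` D))%E.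
  apply: le_trans (@lebesgue_outer_sigma_subadditive R n (fun k => B k `&` D)).
  by apply: le_lebesgue_outer; rewrite -setI_bigcupl; exact: setSI.
apply: le_trans (leeD (sub _) (sub _)) _.
rewrite -nneseriesD//; try by move=> *; exact: lebesgue_outer_ge0.
apply: lee_nneseries => k _; first by rewrite adde_ge0// lebesgue_outer_ge0.
exact: lebesgue_outer_obox_half_space.
Qed.

Lemma measurable_coord (i : 'I_n.+1) :
  measurable_fun setT (fun x : Rn => x ord0 i).
Proof.
move=> _; apply: (measurability _ (RGenInftyO.measurableE R)) => // _ [_ [c ->] <-].
rewrite setTI (_ : _ @^-1` _ = half_space i c); first exact: measurable_half_space.
by apply/seteqP; split => x; rewrite /= in_itv.
Qed.

Lemma measurable_obox a b : measurable (obox a b).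
Proof.
rewrite (_ : obox a b = \bigcap_(i : 'I_n.+1) ((fun x => x ord0 i) @^-1` `]a ord0 i, b ord0 i[)).
  apply: fin_bigcap_measurable => // i _.
  by rewrite -[X in measurable X]setTI; exact: measurable_coord.
apply/seteqP; split=> [x abx i _|x abx i]; first by rewrite /= in_itv /= abx.
by have := abx i I; rewrite /= in_itv.
Qed.

Lemma ball_obox x e : 0 < e -> ball x e = obox (x - const_mx e) (x + const_mx e).
Proof.
move=> e0; apply/seteqP; split=> y.
  move=> [_ xy] i; have := xy ord0 i.
  by rewrite /ball/= !mxE ltr_distlC.
move=> xy; split => // i j; have := xy j.
by rewrite !ord1 !mxE /ball/= ltr_distlC.
Qed.

Lemma ball_rV_le0 x e : e <= 0 -> ball x e = set0.
Proof. by move=> e0; apply/seteqP; split => // y [/lt_geF]; rewrite e0. Qed.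

Lemma measurable_ball_rV x e : measurable (ball x e).
Proof.
have [e0|e0] := ltP 0 e; first by rewrite ball_obox//; exact: measurable_obox.
by rewrite ball_rV_le0.
Qed.

Lemma measurable_open_rV (U : set Rn) : open U -> measurable U.
Proof.
move=> oU.
(* Countably many balls suffice: if 1 / (k + 1) < e / 2 and the rational centre is within 1 / (k +
   1) of x, the ball contains x and lies in the e-ball of x. *)
pose B (q : 'rV[rat]_n.+1 * nat) : set Rn := ball (map_mx ratr q.1 : Rn) q.2.+1%:R^-1.
rewrite (_ : U = \bigcup_(q in [set q | B q `<=` U]) B q); last first.
  apply/seteqP; split=> [x Ux|x [q Bq]]; last exact: Bq.
  have /nbhs_ballP[e /= e0 eU] : nbhs x U by exact: open_nbhs_nbhs.
  have [k ke] : exists k, k.+1%:R^-1 < e / 2.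
    have e2 : 0 < e / 2 := divr_gt0 e0 (ltr0Sn R 1).
    by have [k _ /(_ k (leqnn _))] := near_infty_natSinv_lt (PosNum e2); exists k.
  have /choice[q qP] : forall i, exists q : rat, `|x ord0 i - ratr q| < k.+1%:R^-1.
    move=> i; have [q] := @rat_in_itvoo R (x ord0 i) (x ord0 i + k.+1%:R^-1)
      ltac:(by rewrite ltrDl).
    rewrite in_itv/= => /andP[q1 q2]; exists q.
    by rewrite distrC ger0_norm ?subr_ge0 ?ltW// ltrBlDl.
  have xB : B (\row_i q i, k) x.
    by split => // i j; rewrite /ball/= !mxE distrC !ord1; exact: qP.
  exists (\row_i q i, k) => //= y By; apply: eU.
  rewrite (splitr e); apply: ball_triangle.
    by apply: ball_sym; apply: le_ball xB; exact: ltW.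
  by apply: le_ball By; exact: ltW.
rewrite bigcup_mkcond; apply: countable_bigcupT_measurable.
  exact: (countableP [set: ('rV[rat]_n.+1 * nat)%type]).
by move=> q; case: ifP => _ //; exact: measurable_ball_rV.
Qed.

Lemma measurable_closed_rV (A : set Rn) : closed A -> measurable A.
Proof.
by move=> cA; rewrite -[A]setCK; apply: measurableC; apply: measurable_open_rV; exact: closed_openC.
Qed.

Lemma continuous_measurable_rV (f : Rn -> R) : continuous f -> measurable_fun setT f.
Proof.
move=> /continuousP cf _; apply: (measurability _ (RGenOpens.measurableE R)) => //.
move=> _ [_ [a [b ->]] <-]; rewrite setTI; apply: measurable_open_rV.
by apply: cf; exact: interval_open.
Qed.

Lemma lebesgue_rV_ball_fin x e : (mu (ball x e) < +oo)%E.
Proof.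
have [e0|e0] := ltP 0 e; last by rewrite ball_rV_le0// measure0.
by rewrite ball_obox// (le_lt_trans (lebesgue_outer_obox _ _))// ltry.
Qed.

Lemma compact_measurable_rV (K : set Rn) : compact K -> measurable K.
Proof. by move=> cK; apply: measurable_closed_rV; exact: compact_closed. Qed.

Lemma lebesgue_rV_compact_fin (K : set Rn) : compact K -> (mu K < +oo)%E.
Proof.
move=> cK; have [M [_ KM]] := compact_bounded cK.
(* [KM] bounds K by any number above M, here M + 1; the second 1 gives the strict inequality of the
   open ball. *)
apply: (@le_lt_trans _ _ (mu (ball (0 : Rn) (M + 1 + 1)))); last exact: lebesgue_rV_ball_fin.
apply: le_lebesgue_outer => x Kx.
by rewrite mx_norm_ball /ball_/= sub0r normrN ltr_pwDr// KM// ltrDl.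
Qed.

Lemma lebesgue_rV_sigma_finite : sigma_finite setT mu.
Proof.
exists (fun k : nat => ball (0 : Rn) k%:R).
  apply/seteqP; split => // x _.
  exists (Num.truncn `|x|).+1 => //.
  by rewrite mx_norm_ball /ball_/= sub0r normrN truncnS_gt.
by move=> k; split; [exact: measurable_ball_rV|exact: lebesgue_rV_ball_fin].
Qed.

HB.instance Definition _ :=
  @Measure_isSigmaFinite.Build _ Rn R mu lebesgue_rV_sigma_finite.

Lemma lebesgue_rV_complete : measure_is_complete mu.
Proof. exact: (@measure_is_complete_caratheodory R Rn outer). Qed.

(** Translating a cover by boxes keeps the volumes, which gives one inequality for every v; the
    other is the same inequality for -v. *)
Lemma lebesgue_outer_shift A (v : Rn) :
  outer ((fun x : Rn => x + v) @^-1` A) = outer A.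
Proof.
wlog suff H : A v / (outer ((fun x : Rn => x + v)%R @^-1` A) <= outer A)%E.
  apply/eqP; rewrite eq_le H/=.
  have -> : A = (fun x : Rn => x - v) @^-1` ((fun x : Rn => x + v) @^-1` A).
    by apply/seteqP; split => x /=; rewrite subrK.
  rewrite [leRHS](_ : _ = outer ((fun x : Rn => x + v) @^-1` A)); first exact: H.
  by congr outer; apply/seteqP; split => x /=; rewrite subrK.
apply: le_ereal_inf_tmp => _ [f fA <-].
apply: ereal_inf_lbound; exists (fun k => ((f k).1 - v, (f k).2 - v)).
  move=> x /fA[k _ fk]; exists k => // i.
  by have := fk i; rewrite !mxE ltrBlDr ltrBrDr.
apply: eq_eseriesr => k _; congr (_%:E).
by apply: eq_bigr => i _ /=; rewrite !mxE opprB addrA subrK.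
Qed.

(** The sigma-algebra consists of the Caratheodory sets, so continuity of the translation does not
    settle the matter; Caratheodory's condition is transported by the translation invariance of the
    outer measure. *)
Lemma measurable_shift (v : Rn) : measurable_fun setT (fun x : Rn => x + v).
Proof.
move=> _ A mA; have cA : outer.-caratheodory A := mA.
rewrite setTI; change (outer.-caratheodory ((fun x : Rn => x + v) @^-1` A)) => Y.
have YE : Y = (fun x : Rn => x + v) @^-1` ((fun x : Rn => x - v) @^-1` Y).
  by apply/seteqP; split => x /=; rewrite addrK.
rewrite YE preimage_setC -!preimage_setI !lebesgue_outer_shift.
by rewrite -[LHS](lebesgue_outer_shift Y (- v)); exact: cA.
Qed.

Lemma integral_pushforward_shift (v : Rn) (f : Rn -> \bar R) :
  (\int[pushforward mu (fun x : Rn => x + v)%R]_x f x = \int[mu]_x f x)%E.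
Proof.
apply: eq_measure_integral => [|mv A mA _]; first exact: measurable_shift.
exact: (lebesgue_outer_shift A v).
Qed.

Lemma ge0_integral_shift (v : Rn) (f : Rn -> R) : measurable_fun setT f ->
  (forall x, 0 <= f x) ->
  (\int[mu]_x (f (x + v)%R)%:E = \int[mu]_x (f x)%:E)%E.
Proof.
move=> mf f0; rewrite -(integral_pushforward_shift v (EFin \o f)).
apply: esym; apply: (ge0_integral_pushforward (measurable_shift v)).
- exact: measurableT.
- exact/measurable_EFinP.
- by move=> x _; rewrite lee_fin.
Qed.

Lemma integrable_shift (v : Rn) (f : Rn -> R) :
  mu.-integrable setT (EFin \o f) ->
  mu.-integrable setT (EFin \o (fun x => f (x + v))).
Proof.
move=> /integrableP[/measurable_EFinP mf]; rewrite -[X in (X < _)%E -> _]/(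
  \int[mu]_x (`|f x|)%:E)%E => fi.
have mn : measurable_fun setT (fun x => `|f x|) by exact: measurableT_comp mf.
apply/integrableP; split.
  by apply/measurable_EFinP; exact: (measurableT_comp mf (measurable_shift v)).
apply: le_lt_trans fi; rewrite le_eqVlt; apply/orP; left; apply/eqP.
exact: (ge0_integral_shift v mn (fun x => normr_ge0 (f x))).
Qed.

Lemma Rintegral_shift (v : Rn) (f : Rn -> R) :
  mu.-integrable setT (EFin \o f) ->
  \int[mu]_x f (x + v) = \int[mu]_x f x.
Proof.
move=> fi; rewrite /Rintegral -(integral_pushforward_shift v (EFin \o f)).
congr fine; apply: esym; apply: (integral_pushforward (measurable_shift v)).
- exact: (measurable_int mu fi).
- exact: integrable_shift.
- exact: measurableT.
Qed.

Lemma negligible_shift (v : Rn) (N : set Rn) :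
  mu.-negligible N -> mu.-negligible ((fun x : Rn => x + v) @^-1` N).
Proof.
move=> [A [mA A0 NA]]; exists ((fun x : Rn => x + v) @^-1` A); split.
- by rewrite -[X in measurable X]setTI; exact: measurable_shift.
- by rewrite -A0; exact: lebesgue_outer_shift.
- by move=> x; exact: NA.
Qed.

End lebesgue_rV_theory.

(** * Integration by parts *)

Section difference_quotients.
Context {R : realType} {n : nat}.
Local Notation Rn := 'rV[R]_n.+1.
Local Notation mu := (@lebesgue_rV R n).
Variable Omega : set Rn.
Hypothesis Omega_open : open Omega.
Variable j : 'I_n.+1.
Local Notation e := (delta_mx ord0 j : Rn).

(** A flexible form of the support condition: K may be enlarged, so a union serves for a sum, and a
    larger compact set for the translates. *)
Definition vanishes_outside (K : set Rn) (phi : Rn -> R) : Prop :=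
  forall x, ~ K x -> phi x = 0.

(* A class of test functions in which only the j-th partial derivative is
   controlled. *)
Definition C1c (phi : Rn -> R) : Prop :=
  [/\ continuous phi, forall x, derivable phi x e, continuous (partial j phi) &
    exists K, [/\ compact K, K `<=` Omega & vanishes_outside K phi]].

Lemma test_function_C1c phi : test_function Omega phi -> C1c phi.
Proof.
move=> [sphi cK KO]; split; [exact: (sphi [::]).1|exact: (sphi [::]).2|
  exact: (sphi [:: j]).1|].
exists (closure [set x | phi x != 0]); split => // x Kx.
by apply/eqP; apply: contrapT => /negP phix; apply: Kx; exact: subset_closure.
Qed.

Lemma partialZD a phi psi : C1c phi -> C1c psi ->
  partial j (a *: (phi : Rn -> R^o) + psi) =
  a *: (partial j phi : Rn -> R^o) + partial j psi.
Proof.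
move=> [_ dphi _ _] [_ dpsi _ _]; apply/funext => x.
rewrite /partial (deriveD (derivableZ (k := a) (dphi x)) (dpsi x)).
by rewrite (deriveZ a (dphi x)).
Qed.

Lemma C1cZD a phi psi : C1c phi -> C1c psi ->
  C1c (a *: (phi : Rn -> R^o) + psi).
Proof.
move=> phiC psiC; have linc (f g : Rn -> R) : continuous f -> continuous g ->
    continuous (fun x => a * f x + g x).
  by move=> cf cg x; exact: (cvgD (cvgMr (a := a) (cf x)) (cg x)).
split.
- by have [cphi _ _ _] := phiC; have [cpsi _ _ _] := psiC; exact: linc.
- move=> x; have [_ dphi _ _] := phiC; have [_ dpsi _ _] := psiC.
  exact: (derivableD (derivableZ (k := a) (dphi x)) (dpsi x)).
- rewrite partialZD//.
  by have [_ _ cphi _] := phiC; have [_ _ cpsi _] := psiC; exact: linc.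
- have [_ _ _ [K [cK KO K0]]] := phiC; have [_ _ _ [K' [cK' KO' K0']]] := psiC.
  exists (K `|` K'); split; [exact: compactU|by rewrite subUset|].
  move=> x KKx; rewrite -[LHS]/(a * phi x + psi x) K0 ?K0' ?mulr0 ?addr0//.
    by move=> ?; apply: KKx; right.
  by move=> ?; apply: KKx; left.
Qed.

Lemma C1c0 : C1c (0 : Rn -> R^o).
Proof.
have d0 x : is_derive x e (0 : Rn -> R^o) 0 by exact: (is_derive_cst (0 : R^o)).
have p0 : partial j (0 : Rn -> R^o) = cst 0.
  by apply/funext => x; rewrite /partial derive_val.
split.
- exact: (@cst_continuous Rn R 0).
- by move=> x; have [] := d0 x.
- by rewrite p0; exact: (@cst_continuous Rn R 0).
- by exists set0; split; [exact: compact0|exact: sub0set|].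
Qed.

(** Compactness of K makes one interval (-d, d) of admissible t work for all its points. K' is the
    image of K x [-d/2, d/2] under (x, t) -> x + t v; halving d makes the interval closed. *)
Lemma compact_translates K (v : Rn) : compact K -> K `<=` Omega ->
  exists d K', [/\ 0 < d, compact K', K' `<=` Omega &
    forall x t, K x -> `|t| <= d -> K' (x + t *: v)].
Proof.
move=> cK KO.
have cadd : continuous (fun z : Rn * R => z.1 + z.2 *: v).
  move=> z; apply: cvgD; first exact: cvg_fst.
  by apply: (cvgZl (k := z.2)); exact: cvg_snd.
have nearK : \forall t \near (0 : R), K `<=` [set x | Omega (x + t *: v)].
  have := (compact_near_coveringP K).1 cK R (nbhs (0 : R))
    (fun t x => Omega (x + t *: v)) _.
  apply => x Kx.
  have : nbhs (x + 0 *: v) Omega.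
    by rewrite scale0r addr0; apply: open_nbhs_nbhs; split => //; exact: KO.
  move=> /(cadd (x, 0))[[A B] [/= Ax B0] AB].
  by exists (A, B) => //= -[y t] [/= Ay Bt]; exact: (AB (y, t)).
have /nbhs_ballP[d /= d0 dK] := nearK.
exists (d / 2), [set z.1 + z.2 *: v | z in K `*` `[- (d / 2), d / 2]].
split; first by rewrite divr_gt0.
- apply: continuous_compact; first by apply: continuous_subspaceT; exact: cadd.
  by apply: compact_setX => //; exact: segment_compact.
- move=> y [[x t] [/= Kx]]; rewrite in_itv/= -ler_norml => td <-.
  apply: dK => //; rewrite /ball/= sub0r normrN (le_lt_trans td)//.
  by rewrite ltr_pdivrMr// ltr_pMr// ltr1n.
- by move=> x t Kx td; exists (x, t) => //; split => //=; rewrite in_itv/= -ler_norml.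
Qed.

Lemma partial_vanishes K phi : closed K -> vanishes_outside K phi ->
  vanishes_outside K (partial j phi).
Proof.
move=> cK K0 x Kx; rewrite /partial -(derive_cst (0 : R) x e).
apply: near_eq_derive.
have : nbhs x (~` K) by apply: open_nbhs_nbhs; split => //; exact: closed_openC.
by apply: filterS => y; exact: K0.
Qed.

Lemma continuous_vanishing_bounded K (f : Rn -> R) : compact K -> continuous f ->
  vanishes_outside K f -> exists2 C, 0 <= C & forall x, `|f x| <= C.
Proof.
move=> cK cf K0.
have /compact_bounded[M [_ MK]] : compact (f @` K).
  by apply: continuous_compact => //; exact: continuous_subspaceT.
exists (`|M| + 1) => [|x]; first by rewrite addr_ge0.
have [Kx|Kx] := pselect (K x); last by rewrite K0// normr0 addr_ge0.
by apply: MK; [rewrite (le_lt_trans (ler_norm M))// ltrDl|exists x].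
Qed.

(** The mean value theorem on the line through x in the direction e. The resulting bound on
    difference quotients does not depend on t, as dominated convergence requires. *)
Lemma C1c_lipschitz phi C : C1c phi -> (forall x, `|partial j phi x| <= C) ->
  forall x t, `|phi (x + t *: e) - phi x| <= C * `|t|.
Proof.
move=> [cphi dphi _ _] bC.
pose g x (s : R) := phi (x + s *: e).
have dg x s : is_derive s (1 : R) (g x) (partial j phi (x + s *: e)).
  suff H : (fun h : R => h^-1 *: ((g x \o shift s) (h *: 1) - g x s)) =
      (fun h : R => h^-1 *: ((phi \o shift (x + s *: e)) (h *: e) - phi (x + s *: e))).
    apply: DeriveDef; first by rewrite /derivable H; exact: dphi.
    by rewrite /derive H.
  apply/funext => h; rewrite /g /=; congr (_ *: (phi _ - _)).
  by rewrite [h *: 1]mulr1 scalerDl addrCA.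
have cg x : continuous (g x).
  by move=> s; apply: differentiable_continuous; apply/derivable1_diffP; exact: ex_derive.
have pos x t : 0 <= t -> `|phi (x + t *: e) - phi x| <= C * `|t|.
  move=> t0; have [|c _] := @MVT_segment R (g x) (fun s => partial j phi (x + s *: e)) 0 t t0
    (fun s _ => dg x s).
    by apply: continuous_subspaceT; exact: cg.
  rewrite /g scale0r addr0 subr0 => ->; rewrite normrM.
  by apply: ler_wpM2r.
move=> x t; have [t0|t0] := leP 0 t; first exact: pos.
have := pos (x + t *: e) (- t); rewrite scaleNr addrK normrN distrC; apply.
by rewrite oppr_ge0 ltW.
Qed.

Lemma integrable_mul_vanishing (w psi : Rn -> R) K C :
  measurable_fun setT w -> measurable K -> mu.-integrable K (EFin \o w) ->
  measurable_fun setT psi -> (forall x, `|psi x| <= C) -> vanishes_outside K psi ->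
  mu.-integrable setT (EFin \o (fun x => w x * psi x)).
Proof.
move=> mw mK wi mpsi bC K0.
have wi' : mu.-integrable setT (EFin \o (fun x => C * `|(w \_ K) x|)).
  apply: integrableZ_EFin; apply: integrable_norm.
  by rewrite -restrict_EFin; apply/(integrable_mkcond _ mK).
apply: (integrable_le _ wi'); first exact: measurable_funM.
move=> x; rewrite normrM patchE mulrC.
have [Kx|] := boolP (x \in K); first exact: ler_wpM2r.
by rewrite notin_setE => Kx; rewrite K0// !normr0 mul0r mulr0.
Qed.

End difference_quotients.

(** * The bound on the functional *)

Section key_inequality.
Context {R : realType} {n : nat}.
Local Notation Rn := 'rV[R]_n.+1.
Local Notation mu := (@lebesgue_rV R n).

Lemma ae_le_normr_Rintegral (f g : Rn -> R) :
  mu.-integrable setT (EFin \o f) -> mu.-integrable setT (EFin \o g) ->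
  {ae mu, forall x, `|f x| <= g x} -> (forall x, 0 <= g x) ->
  `|\int[mu]_x f x| <= \int[mu]_x g x.
Proof.
move=> fi gi fg g0; apply: le_trans (le_normr_Rintegral measurableT fi) _.
have fi' := integrable_norm fi.
apply: fine_le.
- exact: (integrable_fin_num measurableT fi').
- exact: (integrable_fin_num measurableT gi).
- apply: ae_ge0_le_integral => //.
  + exact: (measurable_int mu fi').
  + by move=> x _; rewrite lee_fin.
  + exact: (measurable_int mu gi).
  + by apply: filterS fg => x fgx _; rewrite lee_fin.
Qed.

Lemma euclidean_norm_delta (t : R) (j : 'I_n.+1) :
  euclidean_norm (t *: (delta_mx ord0 j : Rn)) = `|t|.
Proof.
rewrite /euclidean_norm (bigD1 j)//= big1 => [|i ij]; last first.
  by rewrite !mxE eqxx (negPf ij) mulr0 expr0n.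
by rewrite !mxE !eqxx mulr1 addr0 sqrtr_sqr.
Qed.

Lemma weak_partial_bound (Omega : set Rn) (j : 'I_n.+1) (w h : Rn -> R)
    (N : set Rn) (phi : Rn -> R) :
  open Omega -> measurable_fun setT w -> measurable_fun setT h ->
  (forall x, 0 <= h x) ->
  (forall K, compact K -> K `<=` Omega -> mu.-integrable K (EFin \o w)) ->
  (forall K, compact K -> K `<=` Omega -> mu.-integrable K (EFin \o h)) ->
  mu.-negligible N ->
  (forall x y, (Omega `\` N) x -> (Omega `\` N) y ->
    `|w x - w y| <= euclidean_norm (x - y) * (h x + h y)) ->
  C1c Omega j phi ->
  `|\int[mu]_x (w x * partial j phi x)| <= 2 * \int[mu]_x (h x * `|phi x|).
Proof.
move=> oO mw mh h0 wi hi N0 wh phiC.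
have [cphi dphi cdphi [K [cK KO K0]]] := phiC.
pose e : Rn := delta_mx ord0 j.
have clK : closed K by exact: compact_closed.
have dK0 := partial_vanishes j clK K0.
have [C C0 dphi_le] := continuous_vanishing_bounded cK cdphi dK0.
have [B B0 phi_le] := continuous_vanishing_bounded cK cphi K0.
have lip := C1c_lipschitz phiC dphi_le.
(* Outside K' both phi and its shifts by at most d vanish, so all the integrands live on one compact
   subset of Omega, where w and h are integrable. *)
have [d [K' [d0 cK' K'O KK']]] := compact_translates oO e cK KO.
have subK : K `<=` K'.
  by move=> x Kx; rewrite -[x]addr0 -(scale0r e); apply: KK' => //; rewrite normr0 ltW.
have K0' : vanishes_outside K' phi by move=> x Kx; apply: K0 => /subK.
pose t k : R := d / k.+1%:R.
have t0 k : 0 < t k by rewrite divr_gt0.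
have td k : `|t k| <= d.
  by rewrite gtr0_norm// ler_pdivrMr// ler_peMr ?ler1n// ltW.
have ct : t @ \oo --> (0 : R).
  rewrite -(mulr0 d); apply: cvgMr.
  by have := @cvg_harmonic R.
have shift_vanish k : vanishes_outside K' (fun x : Rn => phi (x - t k *: e)).
  move=> x Kx; apply: K0 => Kxt; apply: Kx.
  by rewrite -(subrK (t k *: e) x); exact: KK'.
have mphi := continuous_measurable_rV cphi.
have mphit k : measurable_fun setT (fun x : Rn => phi (x - t k *: e)).
  exact: (measurableT_comp mphi (measurable_shift (- (t k *: e)))).
have mK' := compact_measurable_rV cK'.
(* phi is shifted backwards so that w is shifted forwards after the change of variable; hence the
   limit is minus the partial derivative. *)
pose D k (x : Rn) := (t k)^-1 * (phi (x - t k *: e) - phi x).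
have mD k : measurable_fun setT (D k).
  exact: (measurable_funM (measurable_cst (t k)^-1) (measurable_funB (mphit k) mphi)).
have D_le k x : `|D k x| <= C.
  rewrite normrM normfV (gtr0_norm (t0 k)) mulrC ler_pdivrMr//.
  by have := lip x (- t k); rewrite scaleNr normrN (gtr0_norm (t0 k)).
have D_vanish k : vanishes_outside K' (D k).
  by move=> x Kx; rewrite /D shift_vanish// K0'// subrr mulr0.
have cD x : (fun k => D k x) @ \oo --> (- partial j phi x : R).
  (* The derivative is a limit along the punctured neighbourhoods of 0, so t_k != 0 has to be
     carried along. *)
  have ct' : (fun k => - t k) @ \oo --> (0 : R)^'.
    have cnt : (fun k => - t k) @ \oo --> (0 : R) by rewrite -oppr0; exact: cvgN.
    move=> A /cnt H; have {}H : \forall k \near \oo, - t k != 0 -> A (- t k) := H.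
    suff: \forall k \near \oo, A (- t k) by [].
    by apply: filterS H => k; apply; rewrite oppr_eq0 gt_eqF.
  have dl : (fun s : R => s^-1 *: ((phi \o shift x) (s *: e) - phi x)) @ 0^' -->
      partial j phi x := dphi x.
  have /cvgN := cvg_comp _ _ ct' dl.
  have -> // : (fun k => D k x) =
      (fun k => - ((- t k)^-1 *: ((phi \o shift x) ((- t k) *: e) - phi x) : R^o)).
  apply/funext => k; rewrite /D /= scaleNr [- _ + x]addrC.
  by rewrite invrN scaleNr opprK.
have wi' := wi _ cK' K'O; have hi' := hi _ cK' K'O.
have wDi k : mu.-integrable setT (EFin \o (fun x : Rn => w x * D k x)).
  exact: (integrable_mul_vanishing mw mK' wi' (mD k) (D_le k) (D_vanish k)).
have wphii : mu.-integrable setT (EFin \o (fun x : Rn => w x * phi x)).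
  exact: (integrable_mul_vanishing mw mK' wi' mphi phi_le K0').
have wphiti k : mu.-integrable setT (EFin \o (fun x : Rn => w x * phi (x - t k *: e))).
  by apply: (integrable_mul_vanishing mw mK' wi' (mphit k) _ (shift_vanish k)) => x.
have mnphi : measurable_fun setT (fun x => `|phi x|) by exact: measurableT_comp.
have mnphit k : measurable_fun setT (fun x : Rn => `|phi (x - t k *: e)|).
  exact: measurableT_comp.
have hphii : mu.-integrable setT (EFin \o (fun x : Rn => h x * `|phi x|)).
  apply: (integrable_mul_vanishing (C := B) mh mK' hi' mnphi).
    by move=> x; rewrite normr_id.
  by move=> x /K0' ->; rewrite normr0.
have hphiti k : mu.-integrable setT (EFin \o (fun x : Rn => h x * `|phi (x - t k *: e)|)).
  apply: (integrable_mul_vanishing (C := B) mh mK' hi' (mnphit k)).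
    by move=> x; rewrite normr_id.
  by move=> x /(shift_vanish k) ->; rewrite normr0.
have step k : `|\int[mu]_x (w x * D k x)| <=
    \int[mu]_x (h x * (`|phi (x - t k *: e)| + `|phi x|)).
  pose v := t k *: e.
  have E1 : \int[mu]_x (w x * D k x) =
      \int[mu]_x ((t k)^-1 * (w (x + v) * phi x - w x * phi x)).
    have wi1 : mu.-integrable setT (EFin \o (fun x : Rn => w (x + v) * phi x)).
      have := integrable_shift v (wphiti k).
      by rewrite -/v; under [X in _.-integrable _ (_ \o X) -> _]funext do rewrite addrK.
    have S : \int[mu]_x (w (x + v) * phi x) = \int[mu]_x (w x * phi (x - v)).
      rewrite -(Rintegral_shift v (wphiti k)).
      by apply: eq_Rintegral => x _; rewrite -/v addrK.
    rewrite (RintegralZl _ measurableT (integrableB measurableT wi1 wphii)).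
    rewrite (RintegralB measurableT wi1 wphii) S.
    rewrite -(RintegralB measurableT (wphiti k) wphii).
    rewrite -(RintegralZl _ measurableT (integrableB measurableT (wphiti k) wphii)).
    by apply: eq_Rintegral => x _; rewrite /D mulrCA mulrBr.
  have hi1 : mu.-integrable setT (EFin \o (fun x : Rn => h (x + v) * `|phi x|)).
    have := integrable_shift v (hphiti k).
    by rewrite -/v; under [X in _.-integrable _ (_ \o X) -> _]funext do rewrite addrK.
  have E2 : \int[mu]_x (h x * (`|phi (x - v)| + `|phi x|)) =
      \int[mu]_x (h (x + v) * `|phi x| + h x * `|phi x|).
    under eq_Rintegral do rewrite mulrDr.
    rewrite RintegralD//; last exact: hphiti.
    rewrite RintegralD//; congr (_ + _).
    rewrite -(Rintegral_shift v (hphiti k)).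
    by apply: eq_Rintegral => x _; rewrite -/v addrK.
  rewrite E1 E2; apply: ae_le_normr_Rintegral.
  - have -> : (fun x : Rn => (t k)^-1 * (w (x + v) * phi x - w x * phi x)) =
        (fun x => (t k)^-1 * ((w (x + v) - w x) * phi x)).
      by apply/funext => x; rewrite mulrBl.
    apply: integrableZ_EFin.
    have wi1 := integrable_shift v (wphiti k); rewrite -/v in wi1.
    have : mu.-integrable setT (EFin \o (fun x : Rn => w (x + v) * phi (x + v - v) +
        -1 * (w x * phi x))).
      by apply: integrableD_EFin => //; exact: integrableZ_EFin.
    apply: eq_integrable => // x _ /=; rewrite addrK mulN1r.
    by rewrite mulrBl.
  - exact: integrableD_EFin.
  (* The inequality can fail only where x or x + v lies in N, a null set. If x is in K, then x + v
     is in K', so both points lie in Omega; if not, phi x = 0 and both sides vanish. *)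
  - have N1 := negligible_shift v N0.
    apply: negligibleS (negligibleU N0 N1) => x /= bad.
    apply: contrapT => /not_orP[Nx Nxv]; apply: bad.
    rewrite -mulrBl mulrA normrM -mulrDl.
    have [Kx|Kx] := pselect (K x); last by rewrite K0// normr0 !mulr0.
    apply: ler_wpM2r => //; rewrite normrM normfV (gtr0_norm (t0 k)).
    rewrite mulrC ler_pdivrMr// mulrC.
    have := wh (x + v) x; rewrite [x + v]addrC addrK euclidean_norm_delta.
    rewrite (gtr0_norm (t0 k)); apply; split => //.
    + by apply: K'O; rewrite addrC; exact: KK'.
    + by rewrite addrC.
    + exact: KO.
  - by move=> x; rewrite -mulrDl mulr_ge0// addr_ge0.
(* The integrands are dominated by C |w| on K', where C bounds the quotients; the minus sign of the
   limit disappears in the absolute value. *)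
have c1 : (fun k => `|\int[mu]_x (w x * D k x)|) @ \oo -->
    `|\int[mu]_x (w x * partial j phi x)|.
  have : (fun k => \int[mu]_x (w x * D k x)) @ \oo -->
      \int[mu]_x (w x * - partial j phi x).
    apply: (@dominated_cvg_Rintegral _ _ _ _ _ _ (fun x => C * `|(w \_ K') x|)).
    - by move=> k; exact: (measurable_funM mw (mD k)).
    - apply: (measurable_funM mw); apply: measurable_funN.
      exact: continuous_measurable_rV.
    - by move=> x; apply: cvgMr; exact: cD.
    - apply: integrableZ_EFin; apply: integrable_norm.
      by rewrite -restrict_EFin; apply/(integrable_mkcond _ mK').
    - move=> k x; rewrite normrM patchE mulrC.
      have [Kx|] := boolP (x \in K'); first exact: ler_wpM2r.
      by rewrite notin_setE => Kx; rewrite D_vanish// !normr0 mul0r mulr0.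
  move=> /cvg_norm; rewrite (_ : \int[mu]_x _ = -1 * \int[mu]_x (w x * partial j phi x)).
    by rewrite mulN1r normrN.
  rewrite -RintegralZl//.
    by apply: eq_Rintegral => x _; rewrite mulN1r mulrN.
  exact: (integrable_mul_vanishing mw (compact_measurable_rV cK) (wi _ cK KO)
    (continuous_measurable_rV cdphi) dphi_le dK0).
(* By continuity of phi both terms have the limit h |phi|, whence the factor 2; the dominating
   function is 2 B |h| on K'. *)
have c2 : (fun k => \int[mu]_x (h x * (`|phi (x - t k *: e)| + `|phi x|))) @ \oo -->
    2 * \int[mu]_x (h x * `|phi x|).
  rewrite -RintegralZl//.
  apply: (@dominated_cvg_Rintegral _ _ _ _ _ _ (fun x => (2 * B) * `|(h \_ K') x|)).
  - by move=> k; exact: (measurable_funM mh (measurable_funD (mnphit k) mnphi)).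
  - exact: (@measurable_funM _ _ _ _ (cst 2) _ (measurable_cst _) (measurable_funM mh mnphi)).
  - move=> x; rewrite mulrCA; apply: cvgMr; rewrite mulr_natl mulr2n.
    apply: cvgD; last exact: cvg_cst.
    apply: cvg_norm.
    have cxt : (fun k => x - t k *: e) @ \oo --> x.
      rewrite -[X in _ --> X]subr0; apply: cvgB; first exact: cvg_cst.
      by rewrite -(scale0r e); apply: cvgZl.
    exact: (cvg_comp _ _ cxt (cphi x)).
  - apply: integrableZ_EFin; apply: integrable_norm.
    by rewrite -restrict_EFin; apply/(integrable_mkcond _ mK').
  - move=> k x; rewrite normrM patchE mulrC.
    have [Kx|] := boolP (x \in K').
      apply: ler_wpM2r => //; rewrite ger0_norm ?addr_ge0//.
      by rewrite mulr_natl mulr2n lerD.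
    rewrite notin_setE => Kx.
    by rewrite shift_vanish// K0'// !normr0 addr0 !normr0 mul0r mulr0.
by apply: (ler_cvg_to c1 c2); exact: nearW.
Qed.

End key_inequality.

(** * Existence of the weak derivative *)

Section representation.
Context {R : realType} {n : nat}.
Local Notation Rn := 'rV[R]_n.+1.
Local Notation mu := (@lebesgue_rV R n).

Lemma weak_partial_exists (Omega : set Rn) (j : 'I_n.+1) (w h : Rn -> R)
    (N : set Rn) :
  open Omega -> measurable_fun setT w -> measurable_fun setT h ->
  (forall x, 0 <= h x) ->
  (forall K, compact K -> K `<=` Omega -> mu.-integrable K (EFin \o w)) ->
  (forall K, compact K -> K `<=` Omega -> mu.-integrable K (EFin \o h)) ->
  mu.-negligible N ->
  (forall x y, (Omega `\` N) x -> (Omega `\` N) y ->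
    `|w x - w y| <= euclidean_norm (x - y) * (h x + h y)) ->
  exists G : Rn -> R, [/\ measurable_fun setT G, forall x, `|G x| <= 2 * h x &
    forall phi, C1c Omega j phi ->
      \int[mu]_x (w x * partial j phi x) = - \int[mu]_x (G x * phi x)].
Proof.
move=> oO mw mh h0 wi hi N0 wh.
(* With the factor 2 in the weight, the functional is bounded by the weighted norm with constant 1,
   and the density inherits the bound 2h. *)
pose p x := 2 * h x.
have mp : measurable_fun setT p by exact: measurable_funM.
have p0 x : 0 <= p x by rewrite mulr_ge0.
(* The functional is posed on [C1c], which contains the test functions and whose closure under
   linear combinations involves a single derivative. *)
pose L (phi : Rn -> R^o) : R := - \int[mu]_x (w x * partial j phi x).
have wpi phi : C1c Omega j phi ->
    mu.-integrable setT (EFin \o (fun x : Rn => w x * partial j phi x)).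
  move=> [_ _ cdphi [K [cK KO K0]]].
  have dK0 := partial_vanishes j (compact_closed (@norm_hausdorff R Rn) cK) K0.
  have [C C0 dphi_le] := continuous_vanishing_bounded cK cdphi dK0.
  exact: (integrable_mul_vanishing mw (compact_measurable_rV cK) (wi _ cK KO)
    (continuous_measurable_rV cdphi) dphi_le dK0).
have FW phi : C1c Omega j phi -> @weighted_L1 _ Rn R mu p phi.
  move=> [cphi _ _ [K [cK KO K0]]]; have mphi := continuous_measurable_rV cphi.
  have [B B0 phi_le] := continuous_vanishing_bounded cK cphi K0.
  split => //.
  have hphi : mu.-integrable setT (EFin \o (fun x : Rn => h x * `|phi x|)).
    apply: (integrable_mul_vanishing (C := B) mh (compact_measurable_rV cK) (hi _ cK KO)).
    - exact: measurableT_comp.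
    - by move=> x; rewrite normr_id.
    - by move=> x /K0 ->; rewrite normr0.
  have := integrableZ_EFin 2 hphi.
  by apply: eq_integrable => // x _ /=; rewrite mulrA.
have Llin a f g : C1c Omega j f -> C1c Omega j g -> L (a *: f + g) = a * L f + L g.
  move=> fC gC; rewrite /L (partialZD a fC gC) mulrN -opprD; congr (- _).
  rewrite -RintegralZl//; last exact: wpi.
  rewrite -RintegralD//; [|by apply: integrableZ_EFin; exact: wpi|exact: wpi].
  by apply: eq_Rintegral => x _; rewrite -[(_ + _) x]/(a * partial j f x + partial j g x)
    mulrDr mulrCA.
have Lp f : C1c Omega j f -> L f <= @weighted_norm _ Rn R mu p f.
  move=> fC; rewrite (le_trans (ler_norm _))// normrN.
  apply: le_trans (weak_partial_bound oO mw mh h0 wi hi N0 wh fC) _.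
  rewrite -RintegralZl//.
    rewrite le_eqVlt; apply/orP; left; apply/eqP.
    by apply: eq_Rintegral => x _; rewrite mulrA.
  have := integrableZ_EFin 2^-1 (FW _ fC).2.
  by apply: eq_integrable => // x _ /=; rewrite /p -mulrA mulKf.
have [G [mG Gp GL]] := weighted_L1_dual mp p0 (C1c0 Omega j)
  (fun a f g => @C1cZD _ _ Omega j a f g) FW Llin Lp.
exists G; split => // phi phiC.
have := GL _ phiC; rewrite /L => /(congr1 -%R); rewrite opprK => ->; congr (- _).
by apply: eq_Rintegral => x _; rewrite mulrC.
Qed.

End representation.

(** * Measurability of scalar compositions *)

Section strong_measurability.
Context {R : realType} {n : nat}.
Local Notation Rn := 'rV[R]_n.+1.
Local Notation mu := (@lebesgue_rV R n).

Lemma ae_eq_measurable_rV (D : set Rn) (f g : Rn -> R) : measurable D ->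
  ae_eq mu D f g -> measurable_fun D f -> measurable_fun D g.
Proof.
move=> mD fg mf; apply/measurable_EFinP.
apply: (@ae_measurable_fun _ _ _ mu lebesgue_rV_complete D (EFin \o f)).
  by apply: filterS fg => x fgx Dx /=; rewrite fgx.
exact/measurable_EFinP.
Qed.

(** For simple s_k a preimage under f (s_k x) is a finite union of level sets. Convergence holds
    only a.e. on D, so the limsup, measurable everywhere, replaces the limit, and completeness of
    the measure transfers measurability to f (u x). *)
Lemma strongly_measurable_comp (V : normedModType R) (D : set Rn) (u : Rn -> V)
    (f : V -> R) : measurable D -> continuous f ->
  strongly_measurable mu D u -> measurable_fun D (fun x => f (u x)).
Proof.
move=> mD cf [s [ss su]].
have ms k : measurable_fun setT (fun x => f (s k x)).
  have [fs es] := ss k.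
  move=> _ Y mY; rewrite setTI.
  rewrite (_ : _ @^-1` Y = \bigcup_(e in range (s k) `&` f @^-1` Y) (s k @^-1` [set e])).
    apply: fin_bigcup_measurable; first exact: finite_setIl.
    by move=> e _; exact: (es e).1.
  apply/seteqP; split=> [x Yx|x [e [_ Ye] /= xe]]; last by rewrite /preimage/= xe.
  by exists (s k x) => //; split => //; exists x.
apply/measurable_EFinP.
apply: (@ae_measurable_fun _ _ _ mu lebesgue_rV_complete D
  (fun x => limn_esup (fun k => (f (s k x))%:E))).
  apply: filterS su => x sux Dx.
  have c : (fun k => (f (s k x))%:E) @ \oo --> (f (u x))%:E.
    apply/fine_cvgP; split; first exact: nearW.
    by apply: (cvg_comp _ _ (sux Dx)); exact: cf.
  by rewrite limn_esup_lim; apply/cvg_lim => //; exact: cvg_esups.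
apply: measurable_funTS; apply: measurable_fun_limn_esup => k.
exact/measurable_EFinP.
Qed.

End strong_measurability.

(** * Banach function spaces *)

Lemma dual_norm_le1 (R : realType) (V : normedModType R) (f : {linear V -> R^o}) :
  (dual_norm f <= 1)%E -> forall v, `|f v| <= `|v|.
Proof.
move=> f1 v; have [->|v0] := eqVneq v 0; first by rewrite linear0 !normr0.
have nv : 0 < `|v| by rewrite normr_gt0.
have : (`|f (`|v|^-1 *: v)|%:E <= 1)%E.
  apply: le_trans f1; apply: ereal_sup_ubound; exists (`|v|^-1 *: v) => //=.
  by rewrite normrZ normfV normr_id mulVf// gt_eqF.
by rewrite lee_fin linearZ normrZ normfV normr_id ler_pdivrMl// mulr1.
Qed.

Section banach_function_space_theory.
Context {R : realType} {n : nat} {Omega : set 'rV[R]_n.+1}.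
Local Notation Rn := 'rV[R]_n.+1.
Local Notation mu := (@lebesgue_rV R n).
Variable X : banach_function_space Omega.
Hypothesis Omega_open : open Omega.
Implicit Types f g : Rn -> R.

Lemma bfs_mem_measurable f : bfs_mem X f -> measurable_fun Omega f.
Proof.
move=> [F Ff]; apply: (ae_eq_measurable_rV _ Ff); last exact: bfs_measurable.
exact: measurable_open_rV.
Qed.

Lemma bfs_norm_lty f : bfs_mem X f -> (bfs_norm X f < +oo)%E.
Proof.
move=> [F Ff]; apply: (@le_lt_trans _ _ `|F|%:E); last exact: ltry.
by apply: ereal_inf_lbound; exists F.
Qed.

Lemma bfs_mem_scale c f : 0 < c -> bfs_mem X f ->
  bfs_mem X (fun x => c * f x) /\ (bfs_norm X (fun x => c * f x)%R <= c%:E * bfs_norm X f)%E.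
Proof.
move=> c0 fX.
have scale F : ae_eq mu Omega (bfs_rep F) f ->
    ae_eq mu Omega (@bfs_rep _ _ _ X (c *: F)) (fun x => c * f x).
  (* Linearity is stated for [a *: F + G]; a = c - 1 and G = F give c F. *)
  move=> Ff; have := bfs_linear (c - 1) F F.
  rewrite -[X in _ + X]scale1r -scalerDl subrK.
  apply: filterS2 Ff => x Ffx cFx Ox; rewrite cFx// Ffx//.
  by rewrite mulrBl mul1r subrK.
split; first by have [F Ff] := fX; exists (c *: F); exact: scale.
rewrite -lee_pdivrMl//; apply: le_ereal_inf_tmp => _ [F Ff <-].
rewrite lee_pdivrMl//; apply: ereal_inf_lbound; exists (c *: F); first exact: scale.
by rewrite normrZ gtr0_norm.
Qed.

(** [bfs_integral] on K bounds the integral of |f| by a multiple of the norm of f 1_K, which is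
    finite because the ideal property puts f 1_K into X. *)
Lemma bfs_dominated_integrable f g K : measurable_fun Omega f -> bfs_mem X g ->
  {ae mu, forall x, Omega x -> `|f x| <= g x} ->
  compact K -> K `<=` Omega -> mu.-integrable K (EFin \o f).
Proof.
move=> mf gX fg cK KO.
have mO : measurable Omega by exact: measurable_open_rV.
have mK := compact_measurable_rV cK.
have [fX _] := bfs_ideal mf gX fg.
have mfK : measurable_fun Omega (fun x => f x * \1_K x).
  by apply: (measurable_funM mf); exact: measurable_indic.
have fKg : {ae mu, forall x, Omega x -> `|f x * \1_K x| <= g x}.
  apply: filterS fg => x fgx Ox; apply: le_trans (fgx Ox).
  by rewrite normrM ler_piMr// indicE normr_nat lern1 leq_b1.
have [fKX _] := bfs_ideal mfK gX fKg.
have [C C0 intC] := bfs_integral X mK KO (lebesgue_rV_compact_fin cK).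
apply/integrableP; split.
  by apply/measurable_EFinP; exact: measurable_funS mf.
apply: le_lt_trans (intC f fX) _.
by rewrite lte_mul_pinfty ?lee_fin ?(ltW C0)//; exact: (bfs_norm_lty fKX).
Qed.

Lemma bfs_dominated_locally_integrable f g : measurable_fun Omega f -> bfs_mem X g ->
  {ae mu, forall x, Omega x -> `|f x| <= g x} -> locally_integrable_rV Omega f.
Proof.
move=> mf gX fg; split => // K KO cK.
by have /integrableP[] := bfs_dominated_integrable mf gX fg cK KO.
Qed.

(** Values outside Omega carry no meaning, whereas the duality argument runs on the whole space. So
    w and the positive part of h are extended by 0, and the null set of points of Omega where h < 0
    joins N. *)
Lemma hajlasz_weak_partials (w h : Rn -> R) (g : Rn -> R) (N : set Rn) :
  measurable_fun Omega w -> bfs_mem X g ->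
  {ae mu, forall x, Omega x -> `|w x| <= g x} ->
  bfs_mem X h -> {ae mu, forall x, Omega x -> 0 <= h x} -> mu.-negligible N ->
  (forall x y, (Omega `\` N) x -> (Omega `\` N) y ->
    `|w x - w y| <= euclidean_norm (x - y) * (h x + h y)) ->
  forall j, exists G, [/\ is_weak_partial Omega j w G, measurable_fun Omega G &
    {ae mu, forall x, Omega x -> `|G x| <= 2 * h x}].
Proof.
move=> mw gX wg hX h_ge0 N0 wh j.
have mO : measurable Omega by exact: measurable_open_rV.
have mh := bfs_mem_measurable hX.
pose h' : Rn -> R := (fun x => Num.max 0 (h x)) \_ Omega.
pose w' : Rn -> R := w \_ Omega.
have mh' : measurable_fun setT h'.
  by apply/(measurable_restrictT _ mO); apply: measurable_maxr.
have mw' : measurable_fun setT w' by exact/(measurable_restrictT _ mO).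
have h'_ge0 x : 0 <= h' x by rewrite /h' patchE; case: ifP; rewrite // le_max lexx.
have h'E x : Omega x -> 0 <= h x -> h' x = h x.
  by move=> Ox hx; rewrite /h' patchE mem_set// max_r.
have w'E x : Omega x -> w' x = w x by move=> Ox; rewrite /w' patchE mem_set.
have w'i K : compact K -> K `<=` Omega -> mu.-integrable K (EFin \o w').
  move=> cK KO; apply: eq_integrable (bfs_dominated_integrable mw gX wg cK KO).
    exact: compact_measurable_rV.
  by move=> x; rewrite inE => Kx /=; rewrite w'E//; exact: KO.
have h'i K : compact K -> K `<=` Omega -> mu.-integrable K (EFin \o h').
  move=> cK KO; apply: (bfs_dominated_integrable _ hX _ cK KO).
    exact: measurable_funTS.
  by apply: filterS h_ge0 => x hx Ox; rewrite h'E ?ger0_norm ?hx.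
have N0' : mu.-negligible (N `|` [set x | ~ (Omega x -> 0 <= h x)]).
  exact: negligibleU.
have w'h' x y : (Omega `\` (N `|` [set x | ~ (Omega x -> 0 <= h x)])) x ->
    (Omega `\` (N `|` [set x | ~ (Omega x -> 0 <= h x)])) y ->
    `|w' x - w' y| <= euclidean_norm (x - y) * (h' x + h' y).
  move=> [Ox /not_orP[Nx /contrapT hx]] [Oy /not_orP[Ny /contrapT hy]].
  by rewrite !w'E// !h'E ?hx ?hy//; exact: wh.
have [G [mG Gh' GE]] := weak_partial_exists j Omega_open mw' mh' h'_ge0 w'i h'i N0' w'h'.
have Gh : {ae mu, forall x, Omega x -> `|G x| <= 2 * h x}.
  by apply: filterS h_ge0 => x hx Ox; rewrite -h'E ?hx.
have mGO : measurable_fun Omega G by exact: measurable_funTS.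
exists G; split => //; split.
- exact: (bfs_dominated_locally_integrable mw gX wg).
- exact: (bfs_dominated_locally_integrable mGO (bfs_mem_scale (ltr0Sn R 1) hX).1 Gh).
- move=> phi phiT; have phiC := test_function_C1c j phiT.
  have -> : \int[mu]_(x in Omega) (w x * partial j phi x) =
      \int[mu]_x (w' x * partial j phi x).
    rewrite Rintegral_mkcond; apply: eq_Rintegral => x _.
    by rewrite /w' !patchE; case: ifP => // _; rewrite mul0r.
  rewrite (GE _ phiC); congr (- _).
  rewrite [RHS]Rintegral_mkcond; apply: eq_Rintegral => x _.
  rewrite patchE; case: ifPn => //; rewrite notin_setE => Ox.
  (* Outside Omega the extended weight is 0, so the everywhere bound forces G = 0 there and the
     integral over Omega equals the one over the whole space. *)
  have := Gh' x; rewrite /h' patchE memNset// mulr0 normr_le0 => /eqP ->.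
  by rewrite mul0r.
Qed.

End banach_function_space_theory.

(** * The Reshetnyak upper gradient *)

Theorem theorem3p18 (R : realType) (n : nat) (Omega : set 'rV[R]_n.+1)
    (V : completeNormedModType R) (X : banach_function_space Omega)
    (u : 'rV[R]_n.+1 -> V) (h : 'rV[R]_n.+1 -> R)
    (Omega_open : open Omega)
    (X_rnp : radon_nikodym_property (bfs_space X))
    (X_translation : translation_inequality X)
    (u_mem : bochner_space_mem X u)
    (h_mem : bfs_mem X h)
    (h_ge0 : {ae @lebesgue_rV R n, forall x, Omega x -> 0 <= h x})
    (u_h : exists2 N : set 'rV[R]_n.+1, (@lebesgue_rV R n).-negligible N &
      forall x y, (Omega `\` N) x -> (Omega `\` N) y ->
        `|u x - u y| <= euclidean_norm (x - y) * (h x + h y)) :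
  reshetnyak_sobolev_mem X u /\
  exists2 g, reshetnyak_upper_gradient X u g &
    (bfs_norm X g <= (2 * n.+1%:R)%:E * bfs_norm X h)%E.
Proof.
have [N N0 uh] := u_h; have [su uX] := u_mem.
have mO : measurable Omega by exact: measurable_open_rV.
have c0 : 0 < 2 * n.+1%:R :> R by rewrite mulr_gt0.
have [h2X _] := bfs_mem_scale (ltr0Sn R 1) h_mem.
have [gX g_norm] := bfs_mem_scale c0 h_mem.
have mfu (f : {linear V -> R^o}) : continuous f -> measurable_fun Omega (fun x => f (u x)).
  by move=> cf; exact: (@strongly_measurable_comp _ _ V Omega u f mO cf su).
have fu_le (f : {linear V -> R^o}) : (dual_norm f <= 1)%E ->
    {ae @lebesgue_rV R n, forall x, Omega x -> `|f (u x)| <= `|u x|}.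
  by move=> f1; apply: aeW => x _; exact: dual_norm_le1.
have weak (f : {linear V -> R^o}) : continuous f -> (dual_norm f <= 1)%E ->
    forall j, exists G, [/\ is_weak_partial Omega j (fun x => f (u x)) G,
      measurable_fun Omega G &
      {ae @lebesgue_rV R n, forall x, Omega x -> `|G x| <= 2 * h x}].
  move=> cf f1.
  apply: (hajlasz_weak_partials Omega_open (mfu f cf) uX (fu_le f f1) h_mem h_ge0 N0).
  (* A functional of norm at most 1 does not increase distances, so f (u x) satisfies the pointwise
     inequality with the same h. *)
  move=> x y Nx Ny; apply: le_trans (uh x y Nx Ny).
  by rewrite -linearB; exact: dual_norm_le1.
have gu : reshetnyak_upper_gradient X u (fun x => 2 * n.+1%:R * h x).
  split => //.
    by apply: filterS h_ge0 => x hx Ox; rewrite mulr_ge0 ?hx// ltW.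
  move=> f cf f1; have /choice[G GP] := weak f cf f1.
  exists G; split; first by move=> j; have [] := GP j.
  have Gh : {ae @lebesgue_rV R n, forall x, forall j, Omega x -> `|G j x| <= 2 * h x}.
    by apply: filter_forall => j; have [] := GP j.
  apply: filterS2 h_ge0 Gh => x hx Gx Ox.
  have gx : 0 <= 2 * n.+1%:R * h x by rewrite mulr_ge0 ?hx// ltW.
  rewrite -[leRHS](ger0_norm gx) -sqrtr_sqr ler_sqrt ?sqr_ge0//.
  (* The dimension is [n.+1]: the sum of squares is at most n.+1 times (2h)^2, hence at most the
     square of 2 (n.+1) h, because n.+1 <= (n.+1)^2. *)
  apply: (@le_trans _ _ (\sum_(j < n.+1) (2 * h x) ^+ 2)).
    apply: ler_sum => j _; rewrite -real_normK ?num_real//.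
    by rewrite lerXn2r ?nnegrE ?mulr_ge0 ?hx// Gx.
  rewrite sumr_const card_ord -[leLHS]mulr_natl.
  have -> : 2 * n.+1%:R * h x = n.+1%:R * (2 * h x) by rewrite mulrCA mulrA.
  rewrite [leRHS]exprMn.
  by apply: ler_wpM2r; rewrite ?sqr_ge0// expr2 ler_peMl// ler1n.
split; last by exists (fun x => 2 * n.+1%:R * h x).
split => //; last by eexists; exact: gu.
move=> f cf f1; split.
  exact: (bfs_ideal (mfu f cf) uX (fu_le f f1)).1.
move=> j; have [G [Gw mG Gh]] := weak f cf f1 j.
(* The bound |G| <= 2h puts the partial derivative into X by the ideal property. *)
by exists G => //; exact: (bfs_ideal mG h2X Gh).1.
Qed.
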